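(* Let ${\mathscr X}=(0,1]$ with the dyadic partitions $\alpha_m=\{A_\varepsilon:\varepsilon\in{\mathscr E}_m\}$, $m\ge0$, and let $\{\beta_\varepsilon:\varepsilon\in{\mathscr E},\varepsilon\neq\emptyset\}\subset(0,\infty)$ be given, with associated Pólya tree histogram distributions $\Pi_{\alpha_m}$. Equip $M^1((0,1])$ with the tight topology. Then there exists a unique Radon probability measure on $M^1((0,1])$ projecting to $\Pi_{\alpha_m}$ for all $m\ge0$ if and only if, for every $\varepsilon\in{\mathscr E}$, $$\prod_{m\ge0}\frac{\beta_{\varepsilon0^m0}}{\beta_{\varepsilon0^m0}+\beta_{\varepsilon0^m1}}=0,$$ where $0^m$ denotes the string of $m$ zeros.
   Context: ${\mathscr E}_m$ is the set of binary strings of length $m$ (${\mathscr E}_0$ contains only the empty string), ${\mathscr E}=\bigcup_m{\mathscr E}_m$, and $\varepsilon\varepsilon'$ denotes concatenation. For $\varepsilon\in{\mathscr E}_m$ identified with integer $k-1$ written in binary ($0\le k-1<2^m$), $A_\varepsilon=((k-1)2^{-m},k2^{-m}]$, so $A_\varepsilon=A_{\varepsilon0}\cup A_{\varepsilon1}$ with $A_{\varepsilon0}$ the left half. Pólya tree histograms: let $V_{\varepsilon0}$, $\varepsilon\in{\mathscr E}$, be independent with $V_{\varepsilon0}\sim\mathrm{Beta}(\beta_{\varepsilon0},\beta_{\varepsilon1})$ and $V_{\varepsilon1}=1-V_{\varepsilon0}$; for $\varepsilon=e_1\cdots e_m$ put $P(A_\varepsilon)=\prod_{l=1}^mV_{e_1\cdots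 e_l}$, and $\Pi_{\alpha_m}$ is the law of $(P(A_\varepsilon))_{\varepsilon\in{\mathscr E}_m}$ (a coherent system). Tight topology: coarsest making $P\mapsto\int f\,dP$ continuous for bounded continuous $f$; a measure projects to $\Pi_{\alpha_m}$ if $\Pi_{\alpha_m}$ is the law of $(P(A))_{A\in\alpha_m}$. *)

(* Defs.v *)
From HB Require Import structures.
From mathcomp Require Import all_boot all_order all_algebra.
From mathcomp Require Import all_classical all_reals all_analysis.
Set Implicit Arguments. Unset Strict Implicit. Unset Printing Implicit Defensive.
Import Order.TTheory GRing.Theory Num.Theory numFieldTopology.Exports numFieldNormedType.Exports.
Local Open Scope classical_set_scope.
Local Open Scope ring_scope.

Section Defs.
Variable R : realType.

Definition oc01 : set R := [set x | 0 < x <= 1].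

(** M^1((0,1]): Borel probability measures on (0,1], represented as Borel
    probability measures on R carried by (0,1]. *)
Record M1 := MkM1 { m1P :> probability R R ; m1_supp : m1P oc01 = 1%E }.

HB.instance Definition _ := gen_eqMixin M1.
HB.instance Definition _ := gen_choiceMixin M1.

Lemma dirac1_supp : (\d_(1:R) : probability R R) oc01 = 1%E.
Proof. by rewrite /= /dirac indicE mem_set //= /oc01 /=; apply/andP; split. Qed.

HB.instance Definition _ := isPointed.Build M1 (MkM1 dirac1_supp).

Definition bcont (f : R -> R) : Prop :=
  {within oc01, continuous f} /\ exists M : R, forall x, oc01 x -> `|f x| <= M.

Definition intP (P : M1) (f : R -> R) : R :=
  fine (\int[m1P P]_(x in oc01) (f x)%:E)%E.

(** Tight topology on M1: the topology generated by the subbasis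
    { P | \int f dP \in U }, f bounded continuous, U open in R
    (coarsest topology making every P |-> \int f dP continuous). *)
Definition tight_open (O : set M1) : Prop :=
  forall P, O P -> exists (n : nat) (f : 'I_n -> R -> R) (U : 'I_n -> set R),
    (forall i, bcont (f i) /\ open (U i)) /\
    (forall i, U i (intP P (f i))) /\
    [set Q | forall i, U i (intP Q (f i))] `<=` O.

Definition tight_compact (K : set M1) : Prop :=
  forall C : set (set M1), C `<=` tight_open ->
    K `<=` \bigcup_(O in C) O ->
    exists (n : nat) (O : 'I_n -> set M1),
      (forall i, C (O i)) /\ K `<=` \bigcup_(i in [set: 'I_n]) O i.

Definition M1B := g_sigma_algebraType tight_open.

Definition radon (Q : probability M1B R) : Prop :=
  forall B : set M1B, measurable B ->
    Q B = ereal_sup [set Q K | K in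
      [set K : set M1B | tight_compact K /\ measurable K /\ K `<=` B]].

(** Binary strings: e = e_1 ... e_m as [:: e_1; ...; e_m]; true = 1. *)
Definition bin_val (e : seq bool) : nat := foldl (fun n (b : bool) => (n.*2 + b)%N) 0%N e.

Definition dyad (e : seq bool) : set R :=
  [set x | (bin_val e)%:R / 2 ^+ size e < x <= (bin_val e).+1%:R / 2 ^+ size e].

Definition beta_dens (a b : R) (x : R) : R := x `^ (a - 1) * (1 - x) `^ (b - 1).
Definition oo01 : set R := [set x | 0 < x < 1].
Definition beta_law (a b : R) (B : set R) : \bar R :=
  ((\int[lebesgue_measure]_(x in B `&` oo01) (beta_dens a b x)%:E) *
   ((fine (\int[lebesgue_measure]_(x in oo01) (beta_dens a b x)%:E))^-1)%:E)%E.

Definition mutually_independent {d} {Omega : measurableType d}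
  (Pr : probability Omega R) {I : Type} (X : I -> Omega -> R) : Prop :=
  forall (n : nat) (idx : 'I_n -> I), injective idx ->
  forall B : 'I_n -> set R, (forall i, measurable (B i)) ->
    Pr (\bigcap_(i in [set: 'I_n]) (X (idx i) @^-1` B i)) =
    (\prod_(i < n) Pr (X (idx i) @^-1` B i))%E.

(** Given V e (standing for V_{e0}; V_{e1} = 1 - V_{e0}),
    mass V e w = P(A_e) = prod_{l=1}^m V_{e_1...e_l}. *)
Fixpoint massA {Omega : Type} (V : seq bool -> Omega -> R) (pre : seq bool)
  (e : seq bool) (w : Omega) : R :=
  match e with
  | [::] => 1
  | b :: e' => (if b then 1 - V pre w else V pre w) * massA V (rcons pre b) e' w
  end.
Definition mass {Omega : Type} (V : seq bool -> Omega -> R) (e : seq bool) :=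
  massA V [::] e.

(** Q projects to Pi_{alpha_m}: the Q-law of (P(A_e))_{e in E_m} equals the
    law of (P(A_e))_{e in E_m} under the Polya tree construction from V
    (equality of laws on R^{E_m}, tested on measurable rectangles). *)
Definition projects_to {d} {Omega : measurableType d} (Pr : probability Omega R)
  (V : seq bool -> Omega -> R) (Q : probability M1B R) (m : nat) : Prop :=
  forall B : seq bool -> set R, (forall e, measurable (B e)) ->
    Q [set P : M1B | forall e, size e = m -> B e (fine (m1P P (dyad e)))] =
    Pr [set w | forall e, size e = m -> B e (mass V e w)].

End Defs.

(* Main.v *)
(**
  A probability measure on (0,1] is determined by its tree of dyadic masses
  P(A_e); the trees that occur are the additive ones in which the masses of the
  cells e 0^n, which decrease to the empty set, tend to 0.  Conversely such a
  tree x splits (0,1] into nested cells of length x e, and the quantile map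
  matching these cells with the dyadic ones pushes Lebesgue measure to a
  measure with masses x.

  Every bounded continuous f is a pointwise limit of its lower dyadic step
  functions, so each tight neighbourhood of P contains a neighbourhood defined
  by finitely many dyadic masses.  Hence the Borel sets of M^1 are exactly the
  preimages of measurable sets of trees, which gives uniqueness, and every Borel
  probability on M^1 is Radon: closed sets of trees approximate from inside,
  and prescribing a rate at which the masses of e 0^n vanish gives, by
  Tychonoff, compact sets of trees of almost full mass.

  What remains is the existence of some measure.  By independence and
  E V_{e0} = beta_{e0} / (beta_{e0} + beta_{e1}), the mean of P(A_{e 0^n}) is a
  positive constant times the n-th partial product of the statement.  If a
  measure exists these means tend to 0 by bounded convergence; if they tend to 0,
  the random masses, which decrease, vanish almost surely, and the Polya tree
  defines a random element of M^1.
*)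

Require Import Defs.
From HB Require Import structures.
From mathcomp Require Import all_boot all_order all_algebra.
From mathcomp Require Import ring lra finmap.
From mathcomp Require Import all_classical all_reals all_analysis.
From mathcomp Require Import measurable_realfun.
Set Implicit Arguments. Unset Strict Implicit. Unset Printing Implicit Defensive.
Import Order.TTheory GRing.Theory Num.Theory numFieldTopology.Exports numFieldNormedType.Exports.
Local Open Scope classical_set_scope.
Local Open Scope ring_scope.

(** * Additive trees and their nested partitions of (0,1] *)

Section Tree.
Variable R : realType.
Implicit Types (x : seq bool -> R) (e f g : seq bool).

(** Each turn to the right adds the mass of the left sibling that is skipped, so the sum is the
    distance from the left end of the cell of [pre] to that of [pre ++ e]. *)
Fixpoint lo_from x (pre e : seq bool) : R :=
  if e is b :: e' then
    (if b then x (rcons pre false) else 0) + lo_from x (rcons pre b) e'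
  else 0.

Definition lo x e := lo_from x [::] e.

(* A tree of masses cuts (0,1] into consecutive half-open cells of length [x e]; the dyadic partition is the case [x e = 2^-m]. *)
Definition cell x e : set R := [set u | lo x e < u <= lo x e + x e].

Definition tree x := x [::] = 1 /\
  forall e, 0 <= x e /\ x e = x (rcons e false) + x (rcons e true).

Lemma lo_rcons x e b :
  lo x (rcons e b) = lo x e + (if b then x (rcons e false) else 0).
Proof.
rewrite /lo; suff H pre : lo_from x pre (rcons e b) = lo_from x pre e +
    (if b then x (rcons (pre ++ e) false) else 0) by exact: H.
elim: e pre => [|c e IH] pre /=; first by rewrite cats0 addrC.
by rewrite IH cat_rcons addrA.
Qed.

Lemma cell_rcons x e : tree x ->
  cell x e = cell x (rcons e false) `|` cell x (rcons e true).
Proof.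
move=> [_ tx]; have [p0 e0] := tx e.
have [p1 _] := tx (rcons e false); have [p2 _] := tx (rcons e true).
rewrite /cell !lo_rcons addr0; apply/seteqP; split => u /=.
- move=> /andP[h1 h2]; have [h|h] := leP u (lo x e + x (rcons e false)).
    by left; rewrite h1.
  by right; rewrite /= -addrA -e0.
- by move=> [|] /andP[h1 h2]; apply/andP; split; lra.
Qed.

(** The right child starts where the left one ends, and half-open intervals give that point to the
    left child alone. *)
Lemma cell_rcons_inj x e b c u :
  cell x (rcons e b) u -> cell x (rcons e c) u -> b = c.
Proof.
by rewrite /cell /= !lo_rcons; case: b; case: c => //= /andP[? ?] /andP[? ?]; lra.
Qed.

Lemma cell_nil x : tree x -> cell x [::] = @oc01 R.
Proof. by move=> [x1 _]; rewrite /cell /lo /= x1 add0r. Qed.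

Lemma cell_cat x e f : tree x -> cell x (e ++ f) `<=` cell x e.
Proof.
move=> tx; elim/last_ind: f => [|f b IH]; first by rewrite cats0.
rewrite -rcons_cat => u ub; apply: IH; rewrite cell_rcons //.
by case: b ub; [right|left].
Qed.

Lemma cell_oc01 x e : tree x -> cell x e `<=` @oc01 R.
Proof. by move=> tx; rewrite -(cell_nil tx); exact: (@cell_cat x [::] e). Qed.

Lemma cell_exists x (m : nat) u : tree x -> @oc01 R u ->
  exists2 e, size e = m & cell x e u.
Proof.
move=> tx u01; elim: m => [|m [e em]]; first by exists [::]; rewrite ?cell_nil.
by rewrite cell_rcons// => -[] ?; [exists (rcons e false)|exists (rcons e true)];
  rewrite ?size_rcons ?em.
Qed.

Lemma cell_inj x e f u : tree x -> size e = size f ->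
  cell x e u -> cell x f u -> e = f.
Proof.
move=> tx; elim/last_ind: e f => [|e b IH] f; first by case: f.
case/lastP: f => [|f c]; rewrite ?size_rcons// => -[ef] eb fc.
have ?: e = f.
  by apply: IH => //; [move: eb|move: fc]; rewrite -cats1; exact: cell_cat.
by subst f; rewrite (cell_rcons_inj eb fc).
Qed.

(** The cell of [f] lies in that of its prefix of length [size e], and strings of equal length whose
    cells share a point coincide. *)
Lemma cell_nested x e f u : tree x -> cell x e u -> cell x f u ->
  (size e <= size f)%N -> exists g, f = e ++ g.
Proof.
move=> tx eu fu ef; exists (drop (size e) f).
suff {1}-> : e = take (size e) f by rewrite cat_take_drop.
apply: (@cell_inj x _ _ u) => //; first by rewrite size_takel.
by move: fu; rewrite -{1}(cat_take_drop (size e) f); exact: cell_cat.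
Qed.

(** The tree of Lebesgue measure, whose cells are the dyadic intervals; facts about cells of trees
    thus apply to the dyadic partitions too. *)
Definition unif e : R := (2 ^+ size e)^-1.

Lemma tree_unif : tree unif.
Proof.
split=> [|e]; first by rewrite /unif expr0 invr1.
rewrite /unif !size_rcons exprS; split; first by rewrite invr_ge0 exprn_ge0.
by rewrite invfM; lra.
Qed.

Lemma lo_unif e : lo unif e = (bin_val e)%:R / 2 ^+ size e.
Proof.
elim/last_ind: e => [|e b IH]; first by rewrite /lo /= mul0r.
have p0 : 2 ^+ size e != 0 :> R by rewrite expf_neq0 ?pnatr_eq0.
rewrite lo_rcons IH /bin_val foldl_rcons -/(bin_val e) /unif !size_rcons exprS.
rewrite -muln2 natrD natrM.
have -> : (if b then (2 * 2 ^+ size e)^-1 else 0) = b%:R / (2 * 2 ^+ size e) :> R.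
  by case: b; rewrite ?mul0r ?mul1r.
rewrite [(_ * _)%R in RHS]mulrDl; congr (_ + _).
by rewrite invfM mulrA mulfK ?pnatr_eq0.
Qed.

Lemma dyadE e : dyad e = cell unif e.
Proof.
by rewrite /cell lo_unif /unif -[X in _ + X]mul1r -mulrDl natr1.
Qed.

Lemma dyad_hi e : @dyad R e (lo unif e + unif e).
Proof.
by rewrite dyadE /cell /= lexx ltrDl invr_gt0 exprn_gt0.
Qed.

Lemma lo_nseq x e n : lo x (e ++ nseq n false) = lo x e.
Proof.
elim: n => [|n IH]; first by rewrite cats0.
by rewrite -addn1 nseqD catA cats1 lo_rcons addr0.
Qed.

End Tree.

(** * From masses to measures: the quantile map *)

Lemma probability_pushforward d1 d2 (T1 : measurableType d1)
    (T2 : measurableType d2) (R : realType) (P : probability T1 R)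
    (f : T1 -> T2) : measurable_fun setT f ->
  exists Q : probability T2 R, forall A, Q A = P (f @^-1` A).
Proof.
move=> mf; pose f' : {mfun T1 >-> T2} :=
  HB.pack f (isMeasurableFun.Build _ _ _ _ _ mf).
by exists (distribution P f').
Qed.

Lemma measurable_fun_lt d (T : measurableType d) (R : realType) (f : T -> R) :
  (forall r, measurable [set t | f t < r]) -> measurable_fun setT f.
Proof.
move=> mf; apply: (measurability _ (@RGenInftyO.measurableE R)).
move=> _ [_ [r ->] <-]; rewrite setTI.
rewrite (_ : _ @^-1` _ = [set t | f t < r]); first exact: mf.
by apply/seteqP; split => t /=; rewrite in_itv.
Qed.

Lemma measurable_bigcup_count d (T : measurableType d) (I : countType)
    (D : set I) (F : I -> set T) :
  (forall i, D i -> measurable (F i)) -> measurable (\bigcup_(i in D) F i).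
Proof.
move=> mF; rewrite bigcup_mkcond; apply: countable_bigcupT_measurable => // i.
by case: ifPn => // /[!inE]; exact: mF.
Qed.

Lemma measurable_bigcap_count d (T : measurableType d) (I : countType)
    (D : set I) (F : I -> set T) :
  (forall i, D i -> measurable (F i)) -> measurable (\bigcap_(i in D) F i).
Proof.
move=> mF; rewrite -[X in measurable X]setCK setC_bigcap; apply: measurableC.
by apply: measurable_bigcup_count => i Di; exact/measurableC/mF.
Qed.

Section Quantile.
Variable R : realType.
Implicit Types (x : seq bool -> R) (e f g : seq bool).

(** In a tree the masses of [e 0^n] decrease in [n], so one small value for each [k] says that they
    tend to 0; the bounds [1/(k+1)] make this a countable condition. *)
Definition vanishing x :=
  forall e (k : nat), exists n, x (e ++ nseq n false) <= k.+1%:R^-1.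

Definition good x := tree x /\ vanishing x.

Definition hi e : R := lo (@unif R) e + unif R e.

(** A generalised inverse distribution function, read off the tree as an infimum over countably many
    dyadic right endpoints. *)
Definition quantile x (u : R) := inf [set hi e | e in [set e | cell x e u]].

Lemma hi_cell e : cell (@unif R) e (hi e).
Proof. by rewrite -dyadE; exact: dyad_hi. Qed.

Lemma hi_ge0 e : 0 <= hi e.
Proof.
have := cell_oc01 (tree_unif R) (hi_cell e).
by rewrite /oc01 /= => /andP[/ltW].
Qed.

(* The left endpoints of the cells [e 0^n] all agree, so a point of [cell x e] leaves them as soon as their length is small. *)
Lemma cell_leave x e u : vanishing x -> cell x e u ->
  exists n, cell x (e ++ nseq n false) u /\ ~ cell x (e ++ nseq n.+1 false) u.
Proof.
move=> vx eu.
have /andP[h1 h2] := eu.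
have [k hk] : exists k : nat, k.+1%:R^-1 < u - lo x e.
  exists (Num.truncn (u - lo x e)^-1).
  rewrite invf_plt ?posrE ?subr_gt0 ?ltr0n//.
  exact: truncnS_gt.
have [n hn] := vx e k.
have ex : exists n, `[< ~ cell x (e ++ nseq n false) u >].
  exists n; apply/asboolP => /andP[_]; rewrite lo_nseq; apply/negP.
  by rewrite -ltNge (le_lt_trans (lerD (lexx _) hn))// addrC -ltrBrDr.
case: (ex_minnP ex) => -[|m] /asboolP nm mmin.
  by exfalso; apply: nm; rewrite cats0.
exists m; split => //.
by apply: contrapT => /asboolP/mmin; rewrite ltnn.
Qed.

(** The upper bound is immediate; the danger is that the infimum falls on the excluded left
    endpoint. Vanishing prevents this, since [u] must leave the cells [e 0^n] at some stage. *)
Lemma quantile_cell x e u : good x -> cell x e u -> dyad e (quantile x u).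
Proof.
move=> [tx vx] eu; rewrite dyadE /cell /=; apply/andP; split; last first.
  apply: ge_inf; last by exists e.
  by exists 0 => _ [f _ <-]; exact: hi_ge0.
have [n [cn ncn]] := cell_leave vx eu.
(* On leaving the zero branch, [u] enters the sibling [e 0^n 1], whose dyadic left endpoint lies
   beyond that of [e] and bounds the infimum from below. *)
pose f := rcons (e ++ nseq n false) true.
have fu : cell x f u.
  move: cn; rewrite cell_rcons// => -[|//] h; exfalso; apply: ncn.
  by rewrite -addn1 nseqD catA cats1.
apply: (@lt_le_trans _ _ (lo (@unif R) f)).
  by rewrite lo_rcons lo_nseq ltrDl /unif invr_gt0 exprn_gt0.
apply: lb_le_inf; first by exists (hi e); exists e.
move=> _ [g gu <-].
(* Cells containing [u] are nested: either [g] extends [f] and [hi g] lies in the dyadic cell of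
   [f], or [f] extends [g] and [hi f <= hi g]. *)
have [fg|/ltnW gf] := leqP (size f) (size g).
  have [h gE] := cell_nested tx fu gu fg.
  have := hi_cell g; rewrite {1}gE => /(cell_cat (tree_unif R)) /andP[/ltW]//.
have [h fE] := cell_nested tx gu fu gf.
have := hi_cell f; rewrite {1}fE => /(cell_cat (tree_unif R)) /andP[_].
by apply: le_trans; have /andP[/ltW] := hi_cell f.
Qed.

Lemma quantile_preimage x e : good x ->
  @oc01 R `&` quantile x @^-1` dyad e = cell x e.
Proof.
move=> gx; have [tx vx] := gx; apply/seteqP; split => u.
  move=> [u01 /= du]; have [f fe fu] := cell_exists (size e) tx u01.
  have := quantile_cell gx fu; move: du; rewrite !dyadE => de df.
  by rewrite (cell_inj (tree_unif R) (esym fe) de df).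
by move=> eu; split; [exact: cell_oc01 eu|exact: quantile_cell].
Qed.

Lemma measurable_cell x e : measurable (cell x e).
Proof.
rewrite (_ : cell x e = `]lo x e, lo x e + x e]%classic); last first.
  by apply/seteqP; split => u; rewrite /cell /= in_itv.
exact: measurable_itv.
Qed.

Lemma measurable_oc01 : measurable (@oc01 R).
Proof. by rewrite -(cell_nil (tree_unif R)); exact: measurable_cell. Qed.

Lemma measurable_dyad e : measurable (@dyad R e).
Proof. by rewrite dyadE; exact: measurable_cell. Qed.

(** An infimum is below [r] as soon as one of its terms is, so the sublevel sets are countable
    unions of cells. Off (0,1] no cell contains [u], and the infimum of the empty set is 0. *)
Lemma measurable_quantile x : tree x -> measurable_fun setT (quantile x).
Proof.
move=> tx; apply: measurable_fun_lt => r.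
rewrite (_ : [set t | _] = (\bigcup_(e in [set e | hi e < r]) cell x e) `|`
    (~` @oc01 R `&` [set _ | 0 < r])).
  apply: measurableU; first by apply: measurable_bigcup_count => *; exact: measurable_cell.
  apply: measurableI; first by apply: measurableC; exact: measurable_oc01.
  by have [h|h] := pselect (0 < r); [rewrite (_ : [set _ | _] = setT)|
     rewrite (_ : [set _ | _] = set0)] => //; apply/seteqP; split.
have out u : ~ @oc01 R u -> quantile x u = 0.
  move=> nu; rewrite /quantile (_ : [set _ | _ in _] = set0) ?inf0//.
  by apply/seteqP; split => // t [e /(cell_oc01 tx)/nu].
apply/seteqP; split => u /=.
  have [u01|nu] := pselect (@oc01 R u); last by right; rewrite -(out u nu).
  have [e _ eu] := cell_exists 0 tx u01.
  move=> /inf_lt[]; first by exists (hi e), e.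
  by move=> _ [f fu <-] fr; left; exists f.
case=> [[e er eu]|[nu r0]]; last by rewrite out.
apply: le_lt_trans er; apply: ge_inf; last by exists e.
by exists 0 => _ [f _ <-]; exact: hi_ge0.
Qed.

Lemma lebesgue_cell x e : tree x -> lebesgue_measure (cell x e) = (x e)%:E.
Proof.
move=> [_ tx]; have [x0 _] := tx e.
rewrite (_ : cell x e = `]lo x e, lo x e + x e]%classic); last first.
  by apply/seteqP; split => u; rewrite /cell /= in_itv.
rewrite lebesgue_measure_itv /= lte_fin ltrDl -EFinD.
have [_|] := ltP; first by rewrite addrC addKr.
by move=> h; congr EFin; apply: le_anti; rewrite x0 h.
Qed.

(** The tree of dyadic masses of [P]; topology and measurability on M^1 are studied through this
    map. *)
Definition ev (P : M1 R) (e : seq bool) : R := fine (m1P P (dyad e)).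

(** Lebesgue measure on (0,1] is pushed forward by [quantile x]: the preimage of the dyadic interval
    of [e] is [cell x e], of length [x e]. *)
Lemma M1_of_tree x : good x -> exists P : M1 R, ev P = x.
Proof.
move=> gx; have [tx vx] := gx.
pose mu := mrestr (@lebesgue_measure R) measurable_oc01.
have mu1 : mu setT = 1%E.
  by rewrite /mu /mrestr setTI -(cell_nil tx) lebesgue_cell // tx.1.
pose mu' : probability (measurableTypeR R) R :=
  HB.pack (mrestr (@lebesgue_measure R) measurable_oc01)
    (Measure_isProbability.Build _ _ _ (mrestr (@lebesgue_measure R) measurable_oc01) mu1).
have [Q QE] := probability_pushforward mu' (measurable_quantile tx).
have Qd e : Q (dyad e) = (x e)%:E.
  rewrite QE -(lebesgue_cell e tx) -(quantile_preimage e gx) /=.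
  by rewrite /mu /mrestr setIC.
have Q1 : Q (@oc01 R) = 1%E.
  by rewrite -(cell_nil (tree_unif R)) -dyadE Qd tx.1.
by exists (MkM1 Q1); apply/funext => e; rewrite /ev /= Qd.
Qed.

End Quantile.

(** * Comparison of the tight topology with the dyadic masses *)

Lemma Rintegral_sum d (T : measurableType d) (R : realType)
    (mu : {measure set T -> \bar R}) (D : set T) (I : Type) (s : seq I)
    (f : I -> T -> R) : measurable D ->
  (forall i, mu.-integrable D (EFin \o f i)) ->
  Rintegral mu D (fun x => \sum_(i <- s) f i x) =
  \sum_(i <- s) Rintegral mu D (f i).
Proof.
move=> mD fi; elim: s => [|i s IH].
  rewrite big_nil -[RHS](mulr0 (fine (mu D))) -[in RHS](mul0r (fine (mu D))).
  under eq_Rintegral do rewrite big_nil.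
  by rewrite /Rintegral integral0 mul0r mulr0.
under eq_Rintegral do rewrite big_cons.
rewrite big_cons -IH RintegralD//.
rewrite (_ : _ \o _ = fun x => (\sum_(i <- s) (f i x)%:E)%E).
  by apply: integrable_sum => // j _; exact: fi.
by apply/funext => x /=; rewrite sumEFin.
Qed.

Lemma bounded_cvg_Rintegral d (T : measurableType d) (R : realType)
    (mu : {finite_measure set T -> \bar R}) (D : set T) (M : R)
    (h : nat -> T -> R) (f : T -> R) : measurable D ->
  (forall n, measurable_fun D (h n)) ->
  (forall x, D x -> (fun n => h n x) @ \oo --> f x) ->
  (forall n x, D x -> `|h n x| <= M) ->
  mu.-integrable D (EFin \o f) /\
  (fun n => Rintegral mu D (h n)) @ \oo --> Rintegral mu D f.
Proof.
move=> mD mh hf hM.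
have [] := @dominated_convergence _ _ _ mu D mD (fun n => EFin \o h n)
  (EFin \o f) (EFin \o cst M).
- by move=> n; apply/measurable_EFinP; exact: mh.
- by apply/measurable_EFinP; exact: (measurable_fun_cvg mh).
- by apply: aeW => x Dx; apply: cvg_EFin; [exact: nearW|exact: hf].
- exact: finite_measure_integrable_cst.
- by apply: aeW => x n Dx; rewrite lee_fin hM.
move=> fi _ cv; split => //; apply: fine_cvg; rewrite /Rintegral fineK//.
exact: integrable_fin_num.
Qed.

Section Portmanteau.
Variable R : realType.
Implicit Types (P Q : M1 R) (f : R -> R) (e : seq bool).

Lemma M1_lty P (A : set R) : measurable A -> (m1P P A < +oo)%E.
Proof. by move=> mA; rewrite (le_lt_trans (probability_le1 _ mA)) ?ltry. Qed.

Lemma bcont_integrable P f : bcont f ->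
  (m1P P).-integrable (@oc01 R) (EFin \o f).
Proof.
move=> [cf [M fM]].
apply: measurable_bounded_integrable; first exact: measurable_oc01.
- by apply: M1_lty; exact: measurable_oc01.
- apply: subspace_continuous_measurable_fun; first exact: measurable_oc01.
  exact: cf.
- exists M; split; first exact: num_real.
  by move=> r Mr x /fM /le_trans; apply; exact: ltW.
Qed.

Lemma bcontN f : bcont f -> bcont (\- f).
Proof.
move=> [cf [M fM]]; split; last by exists M => x /fM; rewrite normrN.
by move=> x; apply: continuousN; exact: cf.
Qed.

Lemma intPN P f : bcont f -> Defs.intP P (\- f) = - Defs.intP P f.
Proof.
move=> bf; rewrite -mulN1r -RintegralZl//=; last 2 first.
- exact: measurable_oc01.
- exact: bcont_integrable.
by apply: eq_Rintegral => x _; rewrite mulN1r.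
Qed.

Definition step m (c : seq bool -> R) (x : R) : R :=
  \sum_(e : m.-tuple bool) c e * \1_(@dyad R e) x.

Lemma step_dyad c e x : dyad e x -> step (size e) c x = c e.
Proof.
move=> ex; rewrite /step (bigD1 (in_tuple e))//= indicE mem_set//= mulr1.
rewrite big1 ?addr0// => f fe; rewrite indicE memNset ?mulr0//.
move/negP: fe; apply: contra_not => fx; apply/eqP/val_inj => /=.
move: ex fx; rewrite !dyadE => ex fx.
by rewrite (cell_inj (tree_unif R) _ fx ex)// size_tuple.
Qed.

Lemma measurable_step m c : measurable_fun setT (step m c).
Proof.
apply: measurable_sum => e; apply: measurable_funM; first exact: measurable_cst.
by apply: measurable_indic; exact: measurable_dyad.
Qed.

Lemma Rintegral_step P m c :
  Rintegral (m1P P) (@oc01 R) (step m c) =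
  \sum_(e : m.-tuple bool) c e * ev P e.
Proof.
have mo : measurable (@oc01 R) by exact: measurable_oc01.
have ii e : (m1P P).-integrable (@oc01 R) (EFin \o (\1_(@dyad R e) : R -> R)).
  apply: (integrableS measurableT mo (@subsetT _ _)).
  by apply: integrable_indic; exact: measurable_dyad.
rewrite /step Rintegral_sum//; last first.
  by move=> e; exact: (@integrableZl _ _ _ _ _ mo (c e) _ (ii e)).
apply: eq_bigr => e _; rewrite RintegralZl//; congr (_ * _).
rewrite /Rintegral integral_indic//; last exact: measurable_dyad.
rewrite /ev (setIidl _)//; rewrite dyadE; apply: cell_oc01; exact: tree_unif.
Qed.

Lemma dyad_small (x d : R) : 0 < d -> @oc01 R x -> exists N, forall m, (N <= m)%N ->
  exists e, [/\ size e = m, dyad e x & forall y, dyad e y -> @oc01 R y /\ `|x - y| < d].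
Proof.
move=> d0 x01; have [N hN] : exists N : nat, (2 ^+ N)^-1 < d.
  exists (Num.truncn d^-1).+1.
  rewrite invf_plt ?posrE ?exprn_gt0//.
  apply: (lt_le_trans (truncnS_gt _)).
  by rewrite -natrX ler_nat ltnW// ltn_expl.
exists N => m Nm.
have [e em ex] := cell_exists m (tree_unif R) x01.
rewrite -dyadE in ex; exists e; split => // y; move: ex; rewrite dyadE => ex ey.
split; first exact: (cell_oc01 (tree_unif R)) ey.
move: ex ey => /andP[h1 h2] /andP[h3 h4].
apply: le_lt_trans hN.
have : unif R e <= (2 ^+ N)^-1.
  by rewrite /unif em lef_pV2 ?posrE ?exprn_gt0// ler_weXn2l// ler1n.
by move=> h; rewrite ler_norml; apply/andP; split; lra.
Qed.

Definition inf_dyad f e := inf (f @` @dyad R e).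

Lemma inf_dyad_le f M e x : (forall x, @oc01 R x -> `|f x| <= M) -> dyad e x ->
  inf_dyad f e <= f x.
Proof.
move=> fM ex; apply: ge_inf; last by exists x.
exists (- M) => _ [y ey <-].
by have := fM y; rewrite ler_norml => /(_ _)/andP[]//;
  apply: (cell_oc01 (tree_unif R)); rewrite -dyadE; exact: ey.
Qed.

(** The dyadic interval of level [m] around [x] shrinks to [x], so by continuity at [x] the infimum
    of [f] over it is eventually within [eps] of [f x]; the rate may depend on [x]. *)
Lemma inf_dyad_cvg f x : bcont f -> @oc01 R x ->
  (fun m => step m (inf_dyad f) x) @ \oo --> f x.
Proof.
move=> [cf [M fM]] x01; apply/cvgrPdist_le => eps e0.
have /subspace_continuousP/(_ x x01) := cf.
move=> /cvgrPdist_lt/(_ eps e0); rewrite /within/= => /nbhs_ballP[d /= d0 hd].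
have [N hN] := dyad_small d0 x01.
exists N => // m /= Nm; have [e [em ex ed]] := hN m Nm.
rewrite -em step_dyad//; have le := inf_dyad_le fM ex.
rewrite ger0_norm ?subr_ge0// lerBlDr -lerBlDl.
apply: lb_le_inf; first by exists (f x), x.
move=> _ [y ey <-]; have [y01 xy] := ed y ey.
have := hd y xy y01; rewrite ltr_norml => /andP[_]; rewrite ltrBlDr -ltrBlDl.
by move/ltW.
Qed.

Lemma inf_dyad_bound f M m x : (forall x, @oc01 R x -> `|f x| <= M) ->
  @oc01 R x -> `|step m (inf_dyad f) x| <= M.
Proof.
move=> fM x01; have [e em] := cell_exists m (tree_unif R) x01.
rewrite -dyadE => ex.
rewrite -em step_dyad// ler_norml; apply/andP; split; last first.
  by rewrite (le_trans (inf_dyad_le fM ex))// (le_trans (ler_norm _))// fM.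
apply: lb_le_inf; first by exists (f x), x.
move=> _ [y ey <-]; have := fM y; rewrite ler_norml => /(_ _)/andP[]//.
by apply: (cell_oc01 (tree_unif R)); rewrite -dyadE; exact: ey.
Qed.

(* The step functions [inf_dyad f] stay below [f] and converge to it pointwise on (0,1],
   so no uniform continuity of [f] is needed near 0. *)
Lemma intP_lower_step P f (eta : R) : bcont f -> 0 < eta ->
  exists m c, (forall Q, \sum_(e : m.-tuple bool) c (val e) * ev Q e <= Defs.intP Q f) /\
    Defs.intP P f - eta < \sum_(e : m.-tuple bool) c (val e) * ev P e.
Proof.
move=> bf eta0; have [cf [M fM]] := bf.
have mo : measurable (@oc01 R) by exact: measurable_oc01.
have ms m : measurable_fun (@oc01 R) (step m (inf_dyad f)).
  by apply: measurable_funTS; exact: measurable_step.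
have si Q m : (m1P Q).-integrable (@oc01 R) (EFin \o step m (inf_dyad f)).
  apply: measurable_bounded_integrable => //; first exact: M1_lty.
  exists M; split; first exact: num_real.
  by move=> r Mr x x01 /=; rewrite (le_trans (inf_dyad_bound m fM x01))// ltW.
have [_ cv] := bounded_cvg_Rintegral (m1P P) mo ms
  (fun x x01 => inf_dyad_cvg bf x01) (fun m x => @inf_dyad_bound f M m x fM).
have /cvgrPdist_lt/(_ _ eta0)[N _ /(_ N (leqnn _)) hN] := cv.
exists N, (inf_dyad f); split => [Q|].
  rewrite -Rintegral_step; apply: le_Rintegral => //; [exact: si|exact: bcont_integrable|].
  move=> x x01; have [e em] := cell_exists N (tree_unif R) x01.
  rewrite -dyadE => ex; rewrite -[leLHS]/(step N (inf_dyad f) x) -em step_dyad//.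
  exact: (inf_dyad_le fM ex).
rewrite -Rintegral_step; move: hN; rewrite ltr_norml => /andP[_].
by rewrite ltrBlDr -ltrBlDl.
Qed.

(* A finite list of constraints [p < x e < q] with rational bounds; such lists are countably many. *)
Definition base (k : seq (seq bool * rat * rat)) : set (seq bool -> R) :=
  [set x | forall t, t \in k -> ratr t.1.2 < x t.1.1 < ratr t.2].

Lemma base_cat k l : base (k ++ l) = base k `&` base l.
Proof.
apply/seteqP; split => x /=.
  by move=> h; split=> t tk; apply: h; rewrite mem_cat tk ?orbT.
by move=> [h1 h2] t; rewrite mem_cat => /orP[/h1|/h2].
Qed.

(** By density, rationals can be chosen within [d] of [x e] on either side, for each of the finitely
    many [e]. *)
Lemma base_nbhd (x : seq bool -> R) (s : seq (seq bool)) (d : R) : 0 < d ->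
  exists k, base k x /\
    forall y, base k y -> forall e, e \in s -> `|y e - x e| < d.
Proof.
move=> d0; elim: s => [|e s [k [kx ky]]]; first by exists [::].
have [p /[!in_itv]/= /andP[p1 p2]] : exists p : rat, ratr p \in `]x e - d, x e[.
  by have [|p] := @rat_in_itvoo R (x e - d) (x e); [lra|exists p].
have [q /[!in_itv]/= /andP[q1 q2]] : exists p : rat, ratr p \in `]x e, x e + d[.
  by have [|p'] := @rat_in_itvoo R (x e) (x e + d); [lra|exists p'].
exists ((e, p, q) :: k); split.
  by move=> t; rewrite inE => /predU1P[->/=|/kx//]; rewrite p2 q1.
move=> y hy f; rewrite inE => /predU1P[->|fs].
  have /= /andP[h1 h2] := hy (e, p, q) (mem_head _ _).
  by rewrite ltr_norml; apply/andP; split; lra.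
by apply: ky fs => t tk; apply: hy; rewrite inE tk orbT.
Qed.

(** The integral of a lower step function is linear in finitely many masses: half of [eta] pays for
    replacing [f] by the step function, half for moving the masses. *)
Lemma intP_base P f (eta : R) : bcont f -> 0 < eta ->
  exists k, base k (ev P) /\
    forall Q, base k (ev Q) -> Defs.intP P f - eta < Defs.intP Q f.
Proof.
move=> bf eta0; have eta20 : 0 < eta / 2 by lra.
have [m [c [h1 h2]]] := intP_lower_step P bf eta20.
pose S := \sum_(e : m.-tuple bool) `|c (val e)|.
have S0 : 0 <= S by apply: sumr_ge0.
(* If all masses move by less than this bound, the linear form moves by less than [eta / 2]; the
   [+ 1] covers the case [S = 0]. *)
have d0 : 0 < eta / 2 / (S + 1) by rewrite divr_gt0//; lra.
have [k [kP kQ]] := base_nbhd (ev P) [seq val t | t <- enum {: m.-tuple bool}] d0.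
exists k; split => // Q /kQ close; apply: lt_le_trans (h1 Q).
suff : `|\sum_(e : m.-tuple bool) c (val e) * ev Q e -
         \sum_(e : m.-tuple bool) c (val e) * ev P e| < eta / 2.
  by rewrite ltr_norml => /andP[? ?]; lra.
rewrite -sumrB (le_lt_trans (ler_norm_sum _ _ _))//.
apply: (@le_lt_trans _ _ (S * (eta / 2 / (S + 1)))).
  rewrite /S mulr_suml; apply: ler_sum => e _.
  rewrite -mulrBr normrM ler_wpM2l// ltW// close//.
  by apply: map_f; rewrite mem_enum.
by rewrite mulrCA -[ltRHS]mulr1 ltr_pM2l// ltr_pdivrMr; lra.
Qed.

(** This serves twice: it makes tight open sets countable unions of preimages of base sets, and it
    turns tight covers into covers of sets of trees. *)
Lemma tight_base (O : set (M1 R)) P : tight_open O -> O P ->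
  exists k, base k (ev P) /\ @ev R @^-1` base k `<=` O.
Proof.
move=> oO /oO[n [f [U [bU [UP sub]]]]].
have one i : exists k, base k (ev P) /\
    forall Q, base k (ev Q) -> U i (Defs.intP Q (f i)).
  have [bf oU] := bU i.
  have /nbhs_ballP[eta /= eta0 hU] : nbhs (Defs.intP P (f i)) (U i).
    by apply: open_nbhs_nbhs; split => //; exact: UP.
  (* Lower bounds for the integrals of [f] and of [- f] together enclose the integral on both
     sides. *)
  have [k [kP kQ]] := intP_base P bf eta0.
  have [l [lP lQ]] := intP_base P (bcontN bf) eta0.
  exists (k ++ l); rewrite base_cat; split => // Q [/kQ h1 /lQ].
  rewrite !intPN// => h2; apply: hU.
  by rewrite /ball /= ltr_norml; apply/andP; split; lra.
have [k hk] := choice one.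
exists (flatten [seq k i | i <- enum 'I_n]); split.
  move=> t /flattenP[_ /mapP[i _ ->]]; exact: (hk i).1.
move=> Q hQ; apply: sub => i; apply: (hk i).2 => t tk; apply: hQ.
by apply/flattenP; exists (k i) => //; apply: map_f; rewrite mem_enum.
Qed.

End Portmanteau.

(** * Measurability and uniqueness *)

Section TreeSpace.
Variable R : realType.
Implicit Types (P Q : M1 R) (f : R -> R) (e : seq bool).

Definition cylinders : set (set (seq bool -> R)) :=
  [set A | exists e (B : set R), measurable B /\ A = [set x | B (x e)]].

Definition tree_space := g_sigma_algebraType cylinders.

Lemma measurable_coord e : measurable_fun setT (fun x : tree_space => x e).
Proof.
move=> _ B mB; rewrite setTI; apply: sub_sigma_algebra; exists e, B.
by split.
Qed.

Lemma measurable_tree_space d (T : measurableType d) (f : T -> tree_space) :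
  (forall e, measurable_fun setT (fun t => f t e)) -> measurable_fun setT f.
Proof.
move=> mf; apply: (@measurability _ _ _ tree_space _ f cylinders) => //.
move=> _ [_ [e [B [mB ->]]] <-]; exact: mf.
Qed.

Lemma measurable_base k : measurable (base k : set tree_space).
Proof.
rewrite (_ : base k = \bigcap_(t in [set t | t \in k])
    ((fun x : tree_space => x t.1.1) @^-1` `]ratr t.1.2, ratr t.2[%classic)); last first.
  apply/seteqP; split => x /= h t tk; first by rewrite /= in_itv /=; exact: h.
  by have := h t tk; rewrite /= in_itv.
apply: measurable_bigcap_count => t _.
by rewrite -[X in measurable X]setTI; apply: measurable_coord.
Qed.

Lemma measurable_intP f : bcont f ->
  measurable_fun setT (fun P : M1B R => Defs.intP P f).
Proof.
move=> bf; apply: (measurability _ (RGenOpens.measurableE R)).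
move=> _ [_ [a [b ->]] <-]; rewrite setTI; apply: sub_sigma_algebra => P hP.
exists 1%N, (fun=> f), (fun=> `]a, b[%classic); split; last split => //.
  by move=> _; split => //; exact: interval_open.
by move=> Q /(_ ord0).
Qed.

(** Since [|x - t| + (x - t)] is twice the positive part of [x - t], this continuous function is 1
    up to [t] and below 1 beyond it; its powers tend to the indicator of [x <= t]. *)
Definition ramp (t x : R) : R := (1 + (`|x - t| + (x - t)))^-1.

Lemma ramp_den (t x : R) : 0 <= `|x - t| + (x - t).
Proof. by rewrite -[x in _ + x]opprK subr_ge0 -normrN ler_norm. Qed.

Lemma continuous_ramp t : continuous (ramp t).
Proof.
have c : continuous (fun x : R => x - t).
  by move=> x; apply: cvgB; [exact: cvg_id|exact: cvg_cst].
move=> x; apply: cvgV; first by rewrite gt_eqF// ltr_pwDl// ramp_den.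
by apply: cvgD; [exact: cvg_cst|apply: cvgD; [apply: cvg_norm|]; exact: c].
Qed.

Lemma ramp_ge0 t x : 0 <= ramp t x.
Proof. by rewrite invr_ge0 addr_ge0// ramp_den. Qed.

Lemma ramp_le1 t x : ramp t x <= 1.
Proof. by rewrite invf_le1 ?lerDl ?ramp_den// ltr_pwDl// ramp_den. Qed.

Lemma ramp_cvg t x : (fun n => ramp t x ^+ n) @ \oo --> ((x <= t)%R%:R : R).
Proof.
have [xt|tx] := leP x t.
  rewrite /ramp ler0_norm ?subr_le0// addNr addr0 invr1.
  by under eq_cvg do rewrite expr1n; exact: cvg_cst.
apply: cvg_expr; rewrite ger0_norm ?ramp_ge0// invf_lt1.
  by rewrite gtr0_norm ?subr_gt0// ltrDl addr_gt0 ?subr_gt0.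
by rewrite ltr_pwDl// ramp_den.
Qed.

Definition dyad_ramp e n x := ramp (hi R e) x ^+ n - ramp (lo (unif R) e) x ^+ n.

Lemma dyad_ramp_le1 e n x : `|dyad_ramp e n x| <= 1.
Proof.
have h t : 0 <= ramp t x ^+ n <= 1.
  by rewrite exprn_ge0 ?ramp_ge0// exprn_ile1 ?ramp_ge0// ramp_le1.
have := h (hi R e); have := h (lo (unif R) e); rewrite /dyad_ramp ler_norml.
by move=> /andP[? ?] /andP[? ?]; apply/andP; split; lra.
Qed.

Lemma bcont_dyad_ramp e n : bcont (dyad_ramp e n).
Proof.
split; last by exists 1 => x _; exact: dyad_ramp_le1.
apply: continuous_subspaceT => x; have c t : continuous (fun y : R => ramp t y ^+ n).
  move=> y; apply: (@continuous_comp _ _ _ (ramp t) (fun y => y ^+ n)).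
    exact: continuous_ramp.
  exact: exprn_continuous.
by apply: cvgB; exact: c.
Qed.

Lemma dyad_ramp_cvg e x :
  (fun n => dyad_ramp e n x) @ \oo --> (\1_(@dyad R e) x : R).
Proof.
rewrite (_ : \1_(dyad e) x = (x <= hi R e)%R%:R - (x <= lo (unif R) e)%R%:R).
  by apply: cvgB; exact: ramp_cvg.
rewrite indicE dyadE; have u0 : 0 < unif R e by rewrite invr_gt0 exprn_gt0.
have [h1|h1] := leP x (lo (unif R) e).
  have -> : x <= hi R e by rewrite (le_trans h1)// lerDl ltW.
  by rewrite subrr memNset// => /andP[]; rewrite ltNge h1.
rewrite subr0; have [h2|h2] := leP x (hi R e).
  by rewrite mem_set// /cell /= h1.
by rewrite memNset// => /andP[_]; rewrite leNgt h2.
Qed.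

(** The mass of a dyadic interval need not be tight continuous in [P], but by bounded convergence it
    is a pointwise limit of integrals of bounded continuous functions. *)
Lemma measurable_ev e : measurable_fun setT (fun P : M1B R => ev P e).
Proof.
apply: (@measurable_fun_cvg _ (M1B R) R setT (fun n P => Defs.intP P (dyad_ramp e n))).
  by move=> n; apply: measurable_intP; exact: bcont_dyad_ramp.
move=> P _; have -> : ev P e = Rintegral (m1P P) (@oc01 R) \1_(@dyad R e).
  rewrite /Rintegral integral_indic//; last 2 first.
  - exact: measurable_oc01.
  - exact: measurable_dyad.
  by rewrite /ev setIidl// dyadE; apply: cell_oc01; exact: tree_unif.
apply: (bounded_cvg_Rintegral (M := 1) _ _ _ _ _).2.
- exact: measurable_oc01.
- move=> n; have /integrableP[h _] := bcont_integrable P (bcont_dyad_ramp e n).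
  exact/measurable_EFinP.
- by move=> x _; exact: dyad_ramp_cvg.
- by move=> n x _; exact: dyad_ramp_le1.
Qed.

(** The preimages of measurable sets of trees form a sigma-algebra. It contains the tight open sets,
    because [tight_base] writes each as a union indexed by countably many lists. *)
Lemma M1B_preimage (B : set (M1B R)) : measurable B ->
  exists B' : set tree_space, measurable B' /\ B = @ev R @^-1` B'.
Proof.
pose S : set (set (M1 R)) :=
  [set B | exists B' : set tree_space, measurable B' /\ B = @ev R @^-1` B'].
suff : <<s @tight_open R >> `<=` S by move=> h mB; exact: h.
apply: smallest_sub.
  split.
  - by exists set0; rewrite preimage_set0.
  - move=> _ [B' [mB' ->]]; exists (~` B'); split; first exact: measurableC.
    by rewrite setTD preimage_setC.
  - move=> F /choice[F' hF]; exists (\bigcup_n F' n); split.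
      by apply: bigcupT_measurable => n; exact: (hF n).1.
    by rewrite preimage_bigcup; apply: eq_bigcupr => n _; exact: (hF n).2.
move=> O oO; exists (\bigcup_(k in [set k | @ev R @^-1` base k `<=` O]) base k).
split; first by apply: measurable_bigcup_count => k _; exact: measurable_base.
apply/seteqP; split => P.
  by move=> OP; have [k [kP kO]] := tight_base oO OP; exists k.
by move=> [k kO kP]; exact: kO.
Qed.

Lemma tree_ev P : tree (ev P).
Proof.
split=> [|e].
  by rewrite /ev dyadE (cell_nil (tree_unif R)) m1_supp.
split; first by rewrite fine_ge0.
rewrite /ev !dyadE (cell_rcons e (tree_unif R)) measureU//.
- by rewrite fineD// fin_num_measure//; exact: measurable_cell.
- exact: measurable_cell.
- exact: measurable_cell.
- by apply/seteqP; split => // x [h1 h2]; have := cell_rcons_inj h1 h2.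
Qed.

(** A common point would stay in all the cells [e 0^n] of the uniform tree, which [cell_leave] rules
    out. *)
Lemma bigcap_dyad_nseq e : \bigcap_n @dyad R (e ++ nseq n false) = set0.
Proof.
apply/seteqP; split => // x h.
have v : vanishing (unif R).
  move=> f k; exists k.+1; rewrite /unif size_cat size_nseq.
  rewrite lef_pV2 ?posrE ?exprn_gt0 ?ltr0n//.
  rewrite -natrX ler_nat (leq_trans (ltnW (ltn_expl k.+1 (isT : 1 < 2)%N)))//.
  by rewrite leq_exp2l// leq_addl.
have e0 : cell (unif R) e x by have := h 0%N I; rewrite cats0 dyadE.
have [n [_]] := cell_leave v e0.
by rewrite -dyadE; apply; exact: h.
Qed.

Lemma nonincreasing_dyad_nseq e : nonincreasing_seq (fun n => @dyad R (e ++ nseq n false)).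
Proof.
apply/nonincreasing_seqP => n; apply/subsetPset.
rewrite -addn1 nseqD catA !dyadE; apply: cell_cat; exact: tree_unif.
Qed.

Lemma ev_cvg P e : (fun n => ev P (e ++ nseq n false)) @ \oo --> (0 : R).
Proof.
have -> : 0 = fine (m1P P set0) :> R by rewrite measure0.
rewrite -(bigcap_dyad_nseq e); apply: fine_cvg.
rewrite fineK; last first.
  by rewrite bigcap_dyad_nseq measure0.
apply: nonincreasing_cvg_mu => //.
- by apply: M1_lty; exact: measurable_dyad.
- by move=> n; exact: measurable_dyad.
- by apply: bigcapT_measurable => n; exact: measurable_dyad.
- exact: nonincreasing_dyad_nseq.
Qed.

Lemma good_ev P : good (ev P).
Proof.
split; first exact: tree_ev.
move=> e k; have k0 : 0 < k.+1%:R^-1 :> R by rewrite invr_gt0.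
have /cvgrPdist_lt/(_ _ k0)[N _ /(_ N (leqnn _))] := ev_cvg P e.
by rewrite sub0r normrN => h; exists N; rewrite (le_trans (ler_norm _))// ltW.
Qed.

End TreeSpace.

(** * Uniqueness from the laws of the masses, level by level *)

Section Uniqueness.
Variable R : realType.

Definition level_sets (m : nat) : set (set (M1 R)) :=
  [set A | exists B : seq bool -> set R, (forall e, measurable (B e)) /\
     A = [set P | forall e, size e = m -> B e (ev P e)]].

Definition coarse_sets : set (set (M1 R)) :=
  [set A | exists m (B : seq bool -> set R), (forall e, measurable (B e)) /\
     A = [set P | forall e, (size e <= m)%N -> B e (ev P e)]].

(** Additivity writes the mass of a shorter string as the sum of the masses of its children, so
    induction on [m - size e] reduces to strings of length [m]. *)
Lemma measurable_ev_level m e : (size e <= m)%N ->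
  measurable_fun setT (fun P : g_sigma_algebraType (level_sets m) => ev P e).
Proof.
move=> em; rewrite -(subnK em); move: (m - size e)%N => k {em m}.
elim: k e => [|k IH] e.
  rewrite add0n => _ B mB; rewrite setTI; apply: sub_sigma_algebra.
  exists (fun f => if f == e then B else setT); split.
    by move=> f; case: ifP.
  apply/seteqP; split => P /=.
    by move=> eB f _; case: eqP => [->|].
  by move=> /(_ e erefl); rewrite eqxx.
rewrite (_ : (fun _ => _) = fun P => ev P (rcons e false) + ev P (rcons e true)).
  by apply: measurable_funD; [move: (IH (rcons e false))|move: (IH (rcons e true))];
    rewrite size_rcons addnS -addSn.
by apply/funext => P; have [_ /(_ e)[]] := tree_ev P.
Qed.

Lemma coarse_level m (B : seq bool -> set R) : (forall e, measurable (B e)) ->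
  <<s level_sets m >> [set P | forall e, (size e <= m)%N -> B e (ev P e)].
Proof.
move=> mB.
rewrite (_ : [set P | _] = \bigcap_(e in [set e | (size e <= m)%N])
   ((fun P : g_sigma_algebraType (level_sets m) => ev P e) @^-1` B e)).
  apply: (@measurable_bigcap_count _ (g_sigma_algebraType (level_sets m))).
  by move=> e em; rewrite -[X in measurable X]setTI; exact: measurable_ev_level.
by apply/seteqP; split => P h e em; exact: h.
Qed.

Lemma M1B_coarse (A : set (M1B R)) : measurable A -> <<s coarse_sets >> A.
Proof.
move=> /M1B_preimage[B' [mB' ->]].
suff h : measurable_fun setT (@ev R : g_sigma_algebraType coarse_sets -> tree_space R).
  by rewrite -[X in <<s _ >> X]setTI; exact: h.
apply: measurable_tree_space => e _ B mB; rewrite setTI; apply: sub_sigma_algebra.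
exists (size e), (fun f => if f == e then B else setT); split.
  by move=> f; case: ifP.
apply/seteqP; split => P /=.
  by move=> eB f _; case: eqP => [->|].
by move=> /(_ e (leqnn _)); rewrite eqxx.
Qed.

Lemma measurable_coarse (A : set (M1B R)) : coarse_sets A -> measurable A.
Proof.
move=> [m [B [mB ->]]].
rewrite (_ : [set P | _] = \bigcap_(e in [set e | (size e <= m)%N])
   ((fun P : M1B R => ev P e) @^-1` B e)).
  apply: measurable_bigcap_count => e em; rewrite -[X in measurable X]setTI.
  exact: measurable_ev.
by apply/seteqP; split => P h e em; exact: h.
Qed.

Lemma measurable_level m (A : set (M1B R)) : level_sets m A -> measurable A.
Proof.
move=> [B [mB ->]].
rewrite (_ : [set P | _] = \bigcap_(e in [set e | size e = m])
   ((fun P : M1B R => ev P e) @^-1` B e)).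
  apply: measurable_bigcap_count => e em; rewrite -[X in measurable X]setTI.
  exact: measurable_ev.
by apply/seteqP; split => P h e em; exact: h.
Qed.

(* Sets of a fixed level are stable under intersection but not sets of mixed levels; the
   latter are reduced to the former by additivity, so the pi-lambda theorem is used twice. *)
Lemma M1B_measure_unique (Q Q' : probability (M1B R) R) :
  (forall m A, level_sets m A -> Q A = Q' A) ->
  forall A, measurable A -> Q A = Q' A.
Proof.
move=> QQ' A mA.
have Tl m : level_sets m setT by exists (fun=> setT); split => //; apply/seteqP; split.
have Tc : coarse_sets setT.
  by exists 0%N, (fun=> setT); split => //; apply/seteqP; split.
have fin (Q0 : probability (M1B R) R) : (Q0 setT < +oo)%E by rewrite probability_setT ltry.
apply: (@g_sigma_algebra_measure_unique _ R (M1B R) coarse_sets _ (fun=> setT)).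
- by move=> B; exact: measurable_coarse.
- by [].
- by rewrite bigcup_const.
- move=> _ _ [m [B [mB ->]]] [n [C [mC ->]]].
  exists (maxn m n), (fun e => (if (size e <= m)%N then B e else setT) `&`
                               (if (size e <= n)%N then C e else setT)); split.
    by move=> e; apply: measurableI; case: ifP.
  apply/seteqP; split => P /=.
    by move=> [h1 h2] e _; split; case: ifP => //; [exact: h1|exact: h2].
  move=> h; split => e em.
    by have [] := h e (leq_trans em (leq_maxl _ _)); rewrite em.
  by have [_] := h e (leq_trans em (leq_maxr _ _)); rewrite em.
- move=> _ [m [B [mB ->]]].
  apply: (@g_sigma_algebra_measure_unique _ R (M1B R) (level_sets m) _ (fun=> setT)).
  + by move=> C; exact: measurable_level.
  + by [].
  + by rewrite bigcup_const.
  + move=> _ _ [C [mC ->]] [D [mD ->]].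
    exists (fun e => C e `&` D e); split; first by move=> e; exact: measurableI.
    apply/seteqP; split => P /=.
      by move=> [h1 h2] e em; split; [exact: h1|exact: h2].
    by move=> h; split => e em; have [] := h e em.
  + exact: QQ'.
  + by move=> k; exact: fin.
  + exact: coarse_level.
- by move=> k; exact: fin.
- exact: M1B_coarse.
Qed.

End Uniqueness.

(** * Every Borel probability measure on M1 is Radon *)

Lemma measure_cover_le d (T : measurableType d) (R : realType)
    (mu : {measure set T -> \bar R}) (X : set T) (F : nat -> set T) (eps : R) :
  (forall n, measurable (F n)) -> measurable X -> X `<=` \bigcup_n F n ->
  0 <= eps -> (forall n, (mu (F n) <= (eps / (2 ^ n.+1)%:R)%:E)%E) ->
  (mu X <= eps%:E)%E.
Proof.
move=> mF mX XF e0 hF; have := measure_sigma_subadditive mu mF mX XF; move/le_trans; apply.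
apply: le_trans (epsilon_trick0 xpredT e0).
by apply: lee_nneseries => // n _; exact: hF.
Qed.

(** Continuity from above: were every [mu (F n)] at least [a], so would be the limit. *)
Lemma measure_bigcap_lt d (T : measurableType d) (R : realType)
    (mu : probability T R) (F : nat -> set T) (a : \bar R) :
  (forall n, measurable (F n)) -> nonincreasing_seq F ->
  (mu (\bigcap_n F n) < a)%E -> exists n, (mu (F n) < a)%E.
Proof.
move=> mF dF; rewrite ltNge => /negP h; apply: contrapT => nh; apply: h.
have cv : mu (F n) @[n --> \oo] --> mu (\bigcap_n F n).
  apply: nonincreasing_cvg_mu => //; last exact: bigcapT_measurable.
  by rewrite (le_lt_trans (probability_le1 _ _)) ?ltry.
rewrite -(cvg_lim _ cv)//; apply: lime_ge; first by apply/cvg_ex; eexists; exact: cv.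
by apply: nearW => n; rewrite leNgt; apply/negP => hn; apply: nh; exists n.
Qed.

Lemma continuous_addf (T : topologicalType) (R : realType) (f g : T -> R) :
  continuous f -> continuous g -> continuous (fun x => f x + g x).
Proof. by move=> cf cg x; apply: cvgD; [exact: cf|exact: cg]. Qed.

Lemma continuous_cstf (T : topologicalType) (R : realType) (r : R) :
  continuous (fun _ : T => r).
Proof. by move=> x; exact: cvg_cst. Qed.

Lemma closed_le_fun (T : topologicalType) (R : realType) (f g : T -> R) :
  continuous f -> continuous g -> closed [set x | f x <= g x].
Proof.
move=> cf cg; rewrite (_ : [set x | _] = (fun x => f x - g x) @^-1` [set y | y <= 0]).
  apply: closed_comp; last exact: closed_le.
  by move=> x _; apply: cvgB; [exact: cf|exact: cg].
by apply/seteqP; split => x /=; rewrite subr_le0.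
Qed.

Lemma closed_eq_fun (T : topologicalType) (R : realType) (f g : T -> R) :
  continuous f -> continuous g -> closed [set x | f x = g x].
Proof.
move=> cf cg; rewrite (_ : [set x | _] = [set x | f x <= g x] `&` [set x | g x <= f x]).
  by apply: closedI; exact: closed_le_fun.
by apply/seteqP; split => x /=; [move=> ->|move=> [h1 h2]; apply/le_anti/andP].
Qed.

(** * Inner regularity by closed sets of the product space *)

Section Regularity.
Variable R : realType.

Let X := prod_topology (fun _ : seq bool => R).

Definition closed_measurable_set (F : set (tree_space R)) :=
  closed (F : set X) /\ measurable F.

Definition inner_regular (L : set (tree_space R) -> \bar R) (A : set (tree_space R)) :=
  forall eps : R, 0 < eps -> exists F,
    [/\ closed_measurable_set F, F `<=` A & (L (A `\` F) < eps%:E)%E].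

Lemma coord_continuous (e : seq bool) : continuous (fun x : X => x e).
Proof. exact: (@proj_continuous _ (fun _ : seq bool => R) e). Qed.

Lemma measurable_coord_le (f g : tree_space R -> R) :
  measurable_fun setT f -> measurable_fun setT g -> measurable [set x | f x <= g x].
Proof.
move=> mf mg; rewrite -[X in measurable X]setTI.
rewrite (_ : [set x | _] = (fun x => f x <= g x) @^-1` [set true]).
  by apply: measurable_fun_ler.
by apply/seteqP; split.
Qed.

Lemma measurable_coord_eq (f g : tree_space R -> R) :
  measurable_fun setT f -> measurable_fun setT g -> measurable [set x | f x = g x].
Proof.
move=> mf mg; rewrite (_ : [set x | _] = [set x | f x <= g x] `&` [set x | g x <= f x]).
  by apply: measurableI; exact: measurable_coord_le.
by apply/seteqP; split => x /=; [move=> ->|move=> [h1 h2]; apply/le_anti/andP].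
Qed.

Variable L : probability (tree_space R) R.

(** Regularity is asked of [A] and of its complement, so that the class is stable under
    complements. *)
Let D : set (set (tree_space R)) :=
  [set A | [/\ measurable A, inner_regular L A & inner_regular L (~` A)]].

Let D0 : D set0.
Proof.
split => //.
- move=> eps e0; exists set0; split => //; last by rewrite set0D measure0.
  by split => //; exact: closed0.
- move=> eps e0; exists setT; split; [|by rewrite setC0|by rewrite setDT measure0].
  by split => //; exact: closedT.
Qed.

Let DC A : D A -> D (setT `\` A).
Proof.
by move=> [mA iA iA']; rewrite setTD; split=> //; [exact: measurableC|rewrite setCK].
Qed.

Let DU (A : nat -> set (tree_space R)) : (forall n, D (A n)) -> D (\bigcup_n A n).
Proof.
move=> DA; have mA n : measurable (A n) by have [] := DA n.
have mU : measurable (\bigcup_n A n) by exact: bigcupT_measurable.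
(* The covering estimates give weak inequalities; run with [eps / 2], they end strictly below
   [eps]. *)
split=> // eps e0; have e20 : 0 < eps / 2 by rewrite divr_gt0.
all: have en n : 0 < eps / 2 / (2 ^ n.+1)%:R :> R by rewrite divr_gt0// ltr0n expn_gt0.
- have /choice[F hF] n : exists F, [/\ closed_measurable_set F, F `<=` A n &
      (L (A n `\` F) < (eps / 2 / (2 ^ n.+1)%:R)%:E)%E].
    by have [_ iA _] := DA n; exact: iA.
  (* A countable union of closed sets may fail to be closed; continuity from above yields an [N] for
     which the first [N] sets suffice. *)
  pose G N := \bigcup_(n in `I_N) F n.
  have mG N : measurable (G N).
    by apply: bigcup_measurable => n _; have [[]] := hF n.
  have [N hN] : exists N, (L ((\bigcup_n A n) `\` G N) < eps%:E)%E.
    apply: measure_bigcap_lt.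
    + by move=> N; apply: measurableD.
    + apply/nonincreasing_seqP => N; apply/subsetPset => x [Ax nG]; split => //.
      by move=> [n nN Fx]; apply: nG; exists n => //=; rewrite ltnW.
    + apply: (@le_lt_trans _ _ (eps / 2)%:E); last first.
        by rewrite lte_fin ltr_pdivrMr// mulr_natr mulr2n ltrDl.
      apply: (@measure_cover_le _ _ _ L _ (fun n => A n `\` F n)).
      * by move=> n; apply: measurableD => //; have [[]] := hF n.
      * by apply: bigcapT_measurable => N; apply: measurableD.
      * move=> x hx; have [[n _ Ax] _] := hx 0%N I.
        exists n => //; split => // Fx; have [_] := hx n.+1 I.
        by apply; exists n => //=.
      * exact: ltW.
      * by move=> n; have [_ _ /ltW] := hF n.
  exists (G N); split => //.
    split => //; apply: closed_bigcup; first exact: finite_II.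
    by move=> n _; have [[]] := hF n.
  by move=> x [n _ Fx]; exists n => //; have [_ + _] := hF n; exact.
- have /choice[F hF] n : exists F, [/\ closed_measurable_set F, F `<=` ~` A n &
      (L (~` A n `\` F) < (eps / 2 / (2 ^ n.+1)%:R)%:E)%E].
    by have [_ _ iA] := DA n; exact: iA.
  (* For the complement the whole sequence can be used, an intersection of closed sets being
     closed. *)
  exists (\bigcap_n F n); split.
  + split; first by apply: closed_bigI => n _; have [[]] := hF n.
    by apply: bigcapT_measurable => n; have [[]] := hF n.
  + rewrite setC_bigcup => x Fx n _; have [_ + _] := hF n; apply; exact: Fx.
  + apply: (@le_lt_trans _ _ (eps / 2)%:E); last first.
      by rewrite lte_fin ltr_pdivrMr// mulr_natr mulr2n ltrDl.
    apply: (@measure_cover_le _ _ _ L _ (fun n => ~` A n `\` F n)).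
    * by move=> n; apply: measurableD => //; [exact: measurableC|have [[]] := hF n].
    * apply: measurableD; first exact: measurableC.
      by apply: bigcapT_measurable => n; have [[]] := hF n.
    * move=> x [nA nF]; apply: contrapT => h; apply: nF => n _.
      apply: contrapT => nFx; apply: h; exists n => //; split => //.
      by move=> Ax; apply: nA; exists n.
    * exact: ltW.
    * by move=> n; have [_ _ /ltW] := hF n.
Qed.

Let Dray (e : seq bool) (r : R) : D [set x | x e < r].
Proof.
have mle s : measurable [set x : tree_space R | x e <= s].
  by apply: measurable_coord_le; [exact: measurable_coord|exact: measurable_cst].
have mge : measurable [set x : tree_space R | r <= x e].
  by apply: measurable_coord_le; [exact: measurable_cst|exact: measurable_coord].
have CE : [set x : tree_space R | x e < r] = ~` [set x | r <= x e].
  by apply/seteqP; split => x /=; rewrite ltNge => /negP.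
have mlt : measurable [set x : tree_space R | x e < r].
  by rewrite CE; exact: measurableC.
split => //.
- move=> eps e0.
  (* Closed half-spaces increasing to the open one. *)
  pose F (n : nat) := [set x : tree_space R | x e <= r - n.+1%:R^-1].
  have [N hN] : exists N, (L ([set x : tree_space R | (x e < r)%R] `\` F N) < eps%:E)%E.
    apply: measure_bigcap_lt.
    + by move=> n; apply: measurableD => //; exact: mle.
    + apply/nonincreasing_seqP => n; apply/subsetPset => x [xr nF]; split => //.
      move=> Fx; apply: nF; apply: le_trans Fx _.
      by rewrite lerD2l lerN2 lef_pV2 ?posrE ?ltr0n// ler_nat.
    + rewrite (_ : \bigcap_n _ = set0) ?measure0//.
      apply/seteqP; split => // x hx; have [/= xr _] := hx 0%N I.
      have [n hn] : exists n : nat, n.+1%:R^-1 < r - x e.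
        have rx : 0 < r - x e by rewrite subr_gt0.
        have [n _ hn] := near_infty_natSinv_lt (PosNum rx).
        by exists n; exact: (hn n (leqnn _)).
      have [_] := hx n I; apply; rewrite /F /= lerBrDr -lerBrDl; exact: ltW.
  exists (F N); split => //.
  + split; last exact: mle.
    apply: (@closed_le_fun X R (fun x => x e) (fun _ => r - N.+1%:R^-1)).
      exact: coord_continuous.
    exact: continuous_cstf.
  + by move=> x; rewrite /F /= => /le_lt_trans; apply; rewrite ltrBlDr ltrDl invr_gt0.
- rewrite CE setCK => eps e0; exists [set x | r <= x e]; split => //.
  + split => //.
    apply: (@closed_le_fun X R (fun _ => r) (fun x => x e)).
      exact: continuous_cstf.
    exact: coord_continuous.
  + by rewrite setDv measure0.
Qed.

Lemma tree_space_inner_regular A : measurable A -> inner_regular L A.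
Proof.
have DS : sigma_algebra setT D by split; [exact: D0|exact: DC|exact: DU].
suff h : @cylinders R `<=` D.
  by move=> mA; have [] : D A by exact: (smallest_sub DS h) mA.
move=> _ [e [B [mB ->]]].
(* The sets [B] whose cylinder at [e] lies in [D] form a sigma-algebra, so it remains to check the
   rays generating the Borel sets. *)
pose S := [set B : set R | D [set x | B (x e)]].
suff : <<s @RGenInftyO.G R >> `<=` S.
  have mB' : (@RGenInftyO.G R).-sigma.-measurable B.
    by rewrite -RGenInftyO.measurableE; exact: mB.
  by move=> h; exact: h mB'.
apply: smallest_sub.
  split.
  - exact: D0.
  - by move=> C DCx; exact: DC DCx.
  - move=> C hC; rewrite /S /=.
    rewrite (_ : [set x | _] = \bigcup_n [set x | C n (x e)]); first exact: DU.
    by apply/seteqP; split => x [n _ Cx]; exists n.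
move=> _ [r ->]; rewrite /S /=.
rewrite (_ : [set x | _] = [set x | x e < r]); first exact: Dray.
by apply/seteqP; split => x /=; rewrite in_itv.
Qed.

End Regularity.

(** * Compact sets of trees and the Radon property *)

Section Radon.
Variable R : realType.

Let X := prod_topology (fun _ : seq bool => R).

Lemma base_cons k (t : seq bool * rat * rat) : @base R (t :: k) =
  [set x | ratr t.1.2 < x t.1.1 < ratr t.2] `&` base k.
Proof.
rewrite -cat1s base_cat; congr (_ `&` _); apply/seteqP; split => x /=.
  by move=> h; exact: h (mem_head _ _).
by move=> h u; rewrite inE => /eqP ->.
Qed.

Lemma open_base k : open (@base R k : set X).
Proof.
elim: k => [|t k IH]; first by
  rewrite (_ : base [::] = setT); [exact: openT|apply/seteqP; split].
rewrite base_cons; apply: openI => //.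
rewrite (_ : [set x | _] = (fun x : X => x t.1.1) @^-1` `]ratr t.1.2, ratr t.2[%classic).
  apply: open_comp; last exact: interval_open.
  by move=> x _; exact: coord_continuous.
by apply/seteqP; split => x /=; rewrite in_itv.
Qed.

(* [N e k] controls how fast the masses [x (e 0^n)] must vanish; prescribing a rate makes
   this set of good trees compact. *)
Definition compact_trees (N : seq bool -> nat -> nat) : set (seq bool -> R) :=
  [set x | [/\ forall e, 0 <= x e <= 1, x [::] = 1,
    forall e, x e = x (rcons e false) + x (rcons e true) &
    forall e k, x (e ++ nseq (N e k) false) <= k.+1%:R^-1]].

Lemma compact_trees_good N x : compact_trees N x -> good x.
Proof.
move=> [x01 x1 xD xN]; split; last by move=> e k; exists (N e k).
by split => // e; split => //; have /andP[] := x01 e.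
Qed.

(** As a countable intersection of closed conditions on coordinates, the set is seen to be closed
    and measurable condition by condition. *)
Lemma compact_treesE N : compact_trees N =
  (\bigcap_e [set x | 0 <= x e]) `&` (\bigcap_e [set x | x e <= 1]) `&`
  [set x | x [::] = 1] `&`
  (\bigcap_e [set x | x e = x (rcons e false) + x (rcons e true)]) `&`
  (\bigcap_ek [set x | x (ek.1 ++ nseq (N ek.1 ek.2) false) <= ek.2.+1%:R^-1]).
Proof.
apply/seteqP; split => x.
  move=> [x01 x1 xD xN]; split; [split; [split; [split|]|]|] => //.
  - by move=> e _ /=; have /andP[] := x01 e.
  - by move=> e _ /=; have /andP[] := x01 e.
  - by move=> e _; exact: xD.
  - by move=> e _; exact: xN.
move=> [[[[x0 x1] xn] xD] xN]; split => //.
- by move=> e; apply/andP; split; [exact: x0|exact: x1].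
- by move=> e; exact: xD.
- by move=> e k; exact: (xN (e, k)).
Qed.

Lemma closed_compact_trees N : closed (compact_trees N : set X).
Proof.
have cc e := @coord_continuous R e.
rewrite compact_treesE; repeat apply: closedI.
- apply: closed_bigI => e _.
  by apply: (@closed_le_fun X R (fun _ => 0) (fun x => x e)) => //; exact: continuous_cstf.
- apply: closed_bigI => e _.
  by apply: (@closed_le_fun X R (fun x => x e) (fun _ => 1)) => //; exact: continuous_cstf.
- by apply: (@closed_eq_fun X R (fun x => x [::]) (fun _ => 1)) => //; exact: continuous_cstf.
- apply: closed_bigI => e _.
  apply: (@closed_eq_fun X R (fun x => x e) (fun x => x (rcons e false) + x (rcons e true))) => //.
  exact: (@continuous_addf X R (fun x => x (rcons e false)) (fun x => x (rcons e true))).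
- apply: closed_bigI => -[e k] _.
  apply: (@closed_le_fun X R (fun x => x (e ++ nseq (N e k) false)) (fun _ => k.+1%:R^-1)) => //.
  exact: continuous_cstf.
Qed.

Lemma measurable_compact_trees N : measurable (compact_trees N : set (tree_space R)).
Proof.
have mc e := @measurable_coord R e.
rewrite compact_treesE; repeat apply: measurableI.
- apply: measurable_bigcap_count => e _; exact: measurable_coord_le.
- apply: measurable_bigcap_count => e _; exact: measurable_coord_le.
- exact: measurable_coord_eq.
- apply: measurable_bigcap_count => e _; apply: measurable_coord_eq => //.
  exact: measurable_funD.
- apply: measurable_bigcap_count => e _; exact: measurable_coord_le.
Qed.

Lemma compact_compact_trees N : compact (compact_trees N : set X).
Proof.
pose I01 : set X := [set f | forall e, `[0, 1]%classic (f e)].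
have cI : compact I01.
  exact: (@tychonoff (seq bool) (fun _ => R : topologicalType)
    (fun _ => `[0, 1]%classic) (fun _ => @segment_compact R 0 1)).
apply: (subclosed_compact (@closed_compact_trees N) cI).
by move=> x [x01 _ _ _] e /=; rewrite in_itv; exact: x01.
Qed.

(** A tight cover of the preimage induces a cover of [C] by base sets whose preimages lie in members
    of the cover. Goodness makes every point of [C] the tree of some measure, at which the given
    cover can be used. *)
Lemma tight_compact_preimage (C : set X) : compact C ->
  (forall x, C x -> good x) -> tight_compact (@ev R @^-1` C).
Proof.
(* The zero function serves as base point, so that compactness can be read as cover compactness. *)
pose Xp : ptopologicalType := HB.pack (prod_topology (fun _ : seq bool => R))
  (isPointed.Build (prod_topology (fun _ : seq bool => R)) (fun _ => 0)).
rewrite (_ : @compact X = @cover_compact X); last exact: (@compact_cover Xp).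
move=> cC gC F oF KF.
pose D := [set k | exists O, F O /\ @ev R @^-1` base k `<=` O].
have [D' D'D CD'] : finite_subset_cover D (fun k => base k : set X) C.
  apply: cC => [k _|x Cx]; first exact: open_base.
  have [P xE] := M1_of_tree (gC x Cx).
  have [|O FO OP] := KF P; first by rewrite /= xE.
  have [k [kP kO]] := tight_base (oF O FO) OP.
  by exists k; [exists O|rewrite -xE].
have [U hU] : exists U : seq (seq bool * rat * rat) -> set (M1 R), forall k, D k ->
    F (U k) /\ @ev R @^-1` base k `<=` U k.
  have : forall k, exists O, D k -> F O /\ @ev R @^-1` base k `<=` O.
    move=> k; have [[W hW]|nD] := pselect (D k); first by exists W.
    by exists set0.
  by move=> /choice[U hU]; exists U.
pose s := finmap.enum_fset D'.
exists (size s), (fun i => U (nth [::] s i)); split.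
  move=> i; have /D'D : nth [::] s i \in D' by exact: mem_nth.
  by rewrite inE => /hU[].
move=> P /CD'[k /= kD' kP]; have kD : D k by have := D'D _ kD'; rewrite inE.
have iD' : (index k s < size s)%N by rewrite index_mem.
exists (Ordinal iD') => //=; rewrite nth_index//.
exact: (hU k kD).2.
Qed.

Lemma measurable_ev_tree : measurable_fun setT (@ev R : M1B R -> tree_space R).
Proof. by apply: measurable_tree_space => e; exact: measurable_ev. Qed.

Variable Q : probability (M1B R) R.

(** For each pair [(e, k)] the events that the mass of [e 0^n] exceeds [1/(k+1)] decrease to the
    empty set, so some [n] brings the probability below the share of [eps] reserved for the code of
    the pair. *)
Lemma tight_trees (eps : R) : 0 < eps ->
  exists N, (Q (@ev R @^-1` (~` compact_trees N)) <= eps%:E)%E.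
Proof.
move=> e0.
have mev e r : measurable [set P : M1B R | r < ev P e].
  rewrite -[X in measurable X]setTI (_ : [set P | _] = (fun P => ev P e) @^-1` `]r, +oo[%classic).
    by apply: measurable_ev.
  by apply/seteqP; split => P /=; rewrite in_itv/= andbT.
have ex (ek : seq bool * nat) : exists n,
    (Q [set P : M1B R | (ek.2.+1%:R^-1 < ev P (ek.1 ++ nseq n false))%R] <
       (eps / (2 ^ (choice.pickle ek).+1)%:R)%:E)%E.
  apply: (@measure_bigcap_lt _ _ _ Q
    (fun n => [set P : M1B R | ek.2.+1%:R^-1 < ev P (ek.1 ++ nseq n false)])).
  - by move=> n; exact: mev.
  - apply/nonincreasing_seqP => n; apply/subsetPset => P /= /lt_le_trans; apply.
    rewrite -[false :: _]/(nseq n.+1 false) -addn1 nseqD catA cats1.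
    have [_ tP] := tree_ev P; have [_ ->] := tP (ek.1 ++ nseq n false).
    by rewrite lerDl; have [] := tP (rcons (ek.1 ++ nseq n false) true).
  - rewrite (_ : \bigcap_n _ = set0).
      by rewrite measure0 lte_fin divr_gt0// ltr0n expn_gt0.
    apply/seteqP; split => // P h; have [_ /(_ ek.1 ek.2)[n]] := good_ev P.
    by rewrite leNgt => /negP; apply; exact: (h n I).
have [N hN] := choice ex.
exists (fun e k => N (e, k)).
(* The pairs are enumerated by their codes; numbers coding no pair contribute the empty set. *)
pose F n : set (M1B R) := if pickle_inv n is Some ek then
  [set P | ek.2.+1%:R^-1 < ev P (ek.1 ++ nseq (N ek) false)] else set0.
apply: (@measure_cover_le _ _ _ Q _ F) => //.
- by move=> n; rewrite /F; case: pickle_inv.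
- rewrite -[X in measurable X]setTI; apply: measurable_ev_tree => //.
  by apply: measurableC; exact: measurable_compact_trees.
- move=> P /= nP; have [tP vP] := good_ev P; have [ev1 evD] := tP.
  apply: contrapT => h; apply: nP; split => //.
  + move=> e; have [-> _] := evD e; rewrite /= -fine1 fine_le//.
    * by apply: fin_num_measure; exact: measurable_dyad.
    * by apply: probability_le1; exact: measurable_dyad.
  + by move=> e; have [] := evD e.
  + move=> e k; rewrite leNgt; apply/negP => hk; apply: h.
    by exists (choice.pickle (e, k)) => //; rewrite /F pickleK_inv.
- exact: ltW.
- move=> n; rewrite /F; case E : pickle_inv => [ek|].
    have <- : choice.pickle ek = n.
      by have := @pickle_invK (seq bool * nat)%type n; rewrite E.
    exact/ltW/hN.
  by rewrite measure0 lee_fin divr_ge0 ?ltW// ltr0n expn_gt0.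
Qed.

(** The compact set is the preimage of a closed set approximating [B'] from inside, cut down to
    [compact_trees N]; each of the two restrictions costs at most [eps / 2]. *)
Lemma radon_M1 : radon Q.
Proof.
move=> B mB; have [B' [mB' BE]] := M1B_preimage mB.
have [L LE] := probability_pushforward Q measurable_ev_tree.
apply/eqP; rewrite eq_le; apply/andP; split; last first.
  apply: ge_ereal_sup => _ [K [_ [mK KB]] <-].
  by apply: le_measure => //; rewrite inE.
apply/lee_addgt0Pr => eps e0; have e20 : 0 < eps / 2 by rewrite divr_gt0.
have [F [[cF mF] FB hF]] := tree_space_inner_regular L mB' e20.
have [N hN] := tight_trees e20.
pose K : set (M1B R) := @ev R @^-1` (F `&` compact_trees N).
have mpre (A : set (tree_space R)) : measurable A -> measurable (@ev R @^-1` A : set (M1B R)).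
  by move=> mA; rewrite -[X in measurable X]setTI; exact: measurable_ev_tree.
have mK : measurable K.
  by apply: mpre; apply: measurableI => //; exact: measurable_compact_trees.
have KB : K `<=` B by rewrite BE => P [/FB].
have cK : tight_compact K.
  apply: tight_compact_preimage.
    apply: (subclosed_compact _ (@compact_compact_trees N)); last exact: subIsetr.
    by apply: closedI => //; exact: closed_compact_trees.
  by move=> x [_ /compact_trees_good].
apply: (@le_trans _ _ (Q K + eps%:E)%E); last first.
  by rewrite leeD2r//; apply: ereal_sup_ubound; exists K.
have mC := mpre _ (measurableC (measurable_compact_trees N)).
have mBF := mpre _ (measurableD mB' mF).
apply: (@le_trans _ _ (Q (K `|` (@ev R @^-1` (B' `\` F) `|` @ev R @^-1` (~` compact_trees N))))).
  apply: le_measure; rewrite ?inE//.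
    by apply: measurableU => //; exact: measurableU.
  rewrite BE => P BP; have [FP|nF] := pselect (F (ev P)); last by right; left.
  by have [CP|nC] := pselect (compact_trees N (ev P)); [left|right; right].
apply: (le_trans (measureU2 _ _ _)) => //; first exact: measurableU.
rewrite leeD2l//; apply: (le_trans (measureU2 _ _ _)) => //.
by rewrite [in leRHS](splitr eps) EFinD leeD//; move: hF; rewrite LE => /ltW.
Qed.

End Radon.

(** * Independence and means of beta laws *)

Section DensityExtension.
Local Open Scope ereal_scope.
Context d1 d2 (T1 : measurableType d1) (T2 : measurableType d2) (R : realType).
Variables (m1 : {measure set T1 -> \bar R}) (m2 : {measure set T2 -> \bar R}).
Variables (X1 : T1 -> R) (X2 : T2 -> R) (Z1 : T1 -> R) (Z2 : T2 -> R).
Hypothesis mX1 : measurable_fun setT X1.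
Hypothesis mX2 : measurable_fun setT X2.
Hypothesis mZ1 : measurable_fun setT Z1.
Hypothesis mZ2 : measurable_fun setT Z2.
Hypothesis Z1_ge0 : forall t, (0 <= Z1 t)%R.
Hypothesis Z2_ge0 : forall t, (0 <= Z2 t)%R.
Hypothesis eq_indic : forall B : set R, measurable B ->
  \int[m1]_t (Z1 t * \1_B (X1 t))%:E = \int[m2]_t (Z2 t * \1_B (X2 t))%:E.

Import HBNNSimple.

(** The values of [h] are nonnegative, so the absolute values alter nothing; they make each
    coefficient visibly nonnegative for integration term by term. *)
Lemma nnsfun_indic_sum (h : {nnsfun R >-> R}) : exists s : seq R,
  forall x, h x = (\sum_(y <- s) `|y| * \1_(h @^-1` [set y]) x)%R.
Proof.
exists (finmap.enum_fset (fset_set (range h))) => x.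
rewrite [LHS]fimfunE fsbig_finite//=; apply: eq_bigr => y _.
rewrite indicE; have [|_] := boolP (x \in _); last by rewrite !mulr0.
by rewrite inE => /= <-; rewrite ger0_norm.
Qed.

Lemma integral_weight_nnsfun d (T : measurableType d)
    (m : {measure set T -> \bar R}) (X : T -> R) (Z : T -> R)
    (h : R -> R) (s : seq R) : measurable_fun setT h ->
  measurable_fun setT X -> measurable_fun setT Z -> (forall t, (0 <= Z t)%R) ->
  (forall x, h x = (\sum_(y <- s) `|y| * \1_(h @^-1` [set y]) x)%R) ->
  \int[m]_t (Z t * h (X t))%:E =
  \sum_(y <- s) `|y|%:E * \int[m]_t (Z t * \1_(h @^-1` [set y]) (X t))%:E.
Proof.
move=> mh mX mZ Z0 hE.
have mhy y : measurable (h @^-1` [set y]).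
  by rewrite -[X in measurable X]setTI; exact: mh.
have mi y : measurable_fun setT (fun t => Z t * \1_(h @^-1` [set y]) (X t))%R.
  by apply: measurable_funM => //; apply: measurableT_comp => //; exact: measurable_indic.
transitivity (\int[m]_t \sum_(y <- s) `|y|%:E * (Z t * \1_(h @^-1` [set y]) (X t))%:E).
  apply: eq_integral => t _; rewrite hE mulr_sumr -sumEFin; apply: eq_bigr => y _.
  by rewrite -EFinM mulrCA.
rewrite ge0_integral_sum//.
- apply: eq_bigr => y _; rewrite ge0_integralZl//.
  + exact/measurable_EFinP.
  + by move=> t _; rewrite lee_fin mulr_ge0.
- by move=> y; apply: measurable_funeM; exact/measurable_EFinP.
- by move=> y t _; rewrite -EFinM lee_fin !mulr_ge0.
Qed.

(** By linearity the equality passes from indicators to simple functions, and by monotone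
    convergence to [f]. It is applied to independence, to the beta density and to projections. *)
Lemma integral_weight_ext (f : R -> R) : measurable_fun setT f ->
  (forall x, (0 <= f x)%R) ->
  \int[m1]_t (Z1 t * f (X1 t))%:E = \int[m2]_t (Z2 t * f (X2 t))%:E.
Proof.
move=> mf f0.
have mF : measurable_fun setT (EFin \o f) by exact/measurable_EFinP.
pose h := nnsfun_approx measurableT mF.
have hf x : (h n x)%:E @[n --> \oo] --> (f x)%:E.
  by apply: cvg_nnsfun_approx => // y _; rewrite lee_fin.
have lim d (T : measurableType d) (m : {measure set T -> \bar R})
      (X Z : T -> R) :
    measurable_fun setT X -> measurable_fun setT Z -> (forall t, (0 <= Z t)%R) ->
    \int[m]_t (Z t * h n (X t))%:E @[n --> \oo] --> \int[m]_t (Z t * f (X t))%:E.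
  move=> mX mZ Z0.
  have -> : \int[m]_t (Z t * f (X t))%:E =
      \int[m]_t (limn (fun n => (Z t * h n (X t))%:E)).
    apply: eq_integral => t _; apply/esym/cvg_lim => //.
    apply: cvg_EFin; first exact: nearW.
    by apply: cvgMr; exact: (fine_cvg (hf (X t))).
  apply: cvg_monotone_convergence => //.
  - move=> n; apply/measurable_EFinP; apply: measurable_funM => //.
    by apply: measurableT_comp.
  - by move=> n t _; rewrite lee_fin mulr_ge0.
  - move=> t _ a b ab; rewrite lee_fin ler_wpM2l//.
    exact/lefP/nd_nnsfun_approx.
have := lim _ _ m1 _ _ mX1 mZ1 Z1_ge0; have := lim _ _ m2 _ _ mX2 mZ2 Z2_ge0.
rewrite (_ : (fun n => \int[m2]_t (Z2 t * h n (X2 t))%:E) =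
             (fun n => \int[m1]_t (Z1 t * h n (X1 t))%:E)).
  by move=> /cvg_lim <-// /cvg_lim <-.
apply/funext => n; have [s hs] := nnsfun_indic_sum (h n).
rewrite !(integral_weight_nnsfun _ _ _ _ _ hs)//.
by apply: eq_bigr => y _; rewrite eq_indic.
Qed.

End DensityExtension.

(** * Expectations of products of independent variables *)

Section Independence.
Context d (Omega : measurableType d) (R : realType) (Pr : probability Omega R).

Lemma unit_integrable (f : Omega -> R) : measurable_fun setT f ->
  (forall w, 0 <= f w <= 1) -> Pr.-integrable setT (EFin \o f).
Proof.
move=> mf f01; apply: measurable_bounded_integrable => //.
  by rewrite (le_lt_trans (probability_le1 _ measurableT)) ?ltry.
exists 1; split; first exact: num_real.
move=> r r1 w _ /=; rewrite ger0_norm; last by have /andP[] := f01 w.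
by have /andP[_ /le_trans] := f01 w; apply; exact: ltW.
Qed.

Lemma prod_01 (I : Type) (s : seq I) (P : pred I) (f : I -> R) : (forall i, 0 <= f i <= 1) ->
  0 <= \prod_(i <- s | P i) f i <= 1.
Proof.
move=> f01; elim/big_rec: _ => [|i x _ /andP[x0 x1]]; first by rewrite ler01 lexx.
by have /andP[f0 f1] := f01 i; rewrite mulr_ge0// mulr_ile1.
Qed.

Lemma indic_01 (B : set R) x : 0 <= (\1_B x : R) <= 1.
Proof. by rewrite indicE; case: (_ \in _); rewrite ?lexx ?ler01. Qed.

Variables (n : nat) (X : 'I_n -> Omega -> R).
Hypothesis mX : forall i, measurable_fun setT (X i).
Hypothesis indep : forall B : 'I_n -> set R, (forall i, measurable (B i)) ->
  Pr (\bigcap_(i in [set: 'I_n]) (X i @^-1` B i)) =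
  (\prod_(i < n) Pr (X i @^-1` B i))%E.

Let E (f : Omega -> R) := Rintegral Pr setT f.

Let mcomp (g : R -> R) i : measurable_fun setT g ->
  measurable_fun setT (fun w => g (X i w)).
Proof. by move=> mg; exact: measurableT_comp. Qed.

Let E_prod_indic (B : 'I_n -> set R) : (forall i, measurable (B i)) ->
  E (fun w => \prod_i \1_(B i) (X i w)) = \prod_i E (fun w => \1_(B i) (X i w)).
Proof.
move=> mB.
have mpre i : measurable (X i @^-1` B i).
  by rewrite -[X in measurable X]setTI; exact: mX.
have E1 i : E (fun w => \1_(B i) (X i w)) = fine (Pr (X i @^-1` B i)).
  by rewrite /E /Rintegral (integral_indic _ measurableT (mpre i)) setIT.
transitivity (fine (Pr (\bigcap_(i in [set: 'I_n]) (X i @^-1` B i)))).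
  have mI : measurable (\bigcap_(i in [set: 'I_n]) (X i @^-1` B i)).
    by apply: fin_bigcap_measurable.
  rewrite /E /Rintegral -[in RHS](setIT (\bigcap_(i in _) _)) -(integral_indic _ measurableT mI).
  congr fine; apply: eq_integral => w _; congr EFin; rewrite indicE.
  have [|/negP nw] := boolP (w \in _).
    rewrite inE => hw; rewrite big1// => i _; rewrite indicE mem_set//.
    exact: hw.
  have [i hi] : exists i, ~ B i (X i w).
    by apply/existsNP => h; apply: nw; rewrite inE => i _; exact: h.
  by rewrite (bigD1 i)//= indicE memNset// mul0r.
rewrite indep//; under [RHS]eq_bigr do rewrite E1.
rewrite -[RHS]/(fine (_%:E)) -prodEFin; congr fine; apply: eq_bigr => i _.
by rewrite fineK// fin_num_measure.
Qed.

Lemma expectation_prod (g : 'I_n -> R -> R) :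
  (forall i, measurable_fun setT (g i)) -> (forall i x, 0 <= g i x <= 1) ->
  E (fun w => \prod_i g i (X i w)) = \prod_i E (fun w => g i (X i w)).
Proof.
move=> mg g01.
suff H k : (k <= n)%N -> forall (B : 'I_n -> set R) (h : 'I_n -> R -> R),
    (forall i, measurable (B i)) ->
    (forall i : 'I_n, h i = if (i < k)%N then g i else \1_(B i)) ->
    E (fun w => \prod_i h i (X i w)) = \prod_i E (fun w => h i (X i w)).
  by apply: (H n (leqnn n) (fun=> setT)) => // i; rewrite ltn_ord.
(* Replace the indicators by the [g i] one index at a time. *)
elim: k => [|k IH] kn B h mB hE.
  have -> : h = fun i => \1_(B i) by apply/funext => i; rewrite hE.
  exact: E_prod_indic.
pose j := Ordinal kn.
have mh i : measurable_fun setT (h i).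
  by rewrite hE; case: ifP => // _; exact: measurable_indic.
have h01 i x : 0 <= h i x <= 1 by rewrite hE; case: ifP => // _; exact: indic_01.
have hj : h j = g j by rewrite hE /= ltnSn.
pose Z w := \prod_(i | i != j) h i (X i w).
pose c := \prod_(i | i != j) E (fun w => h i (X i w)).
have mZ : measurable_fun setT Z.
  have -> : Z = fun w => \prod_i (if i != j then h i (X i w) else 1).
    by apply/funext => w; rewrite /Z big_mkcond.
  apply: measurable_prod => i _; case: (i != j); first exact: mcomp.
  exact: measurable_cst.
have Z01 w : 0 <= Z w <= 1 by exact: prod_01.
(* The induction hypothesis with the indicator of [C] at index [j] says that the law of [X j]
   weighted by [Z] is [c] times the law of [X j]; [integral_weight_ext] then inserts [g j]. *)
have EI C : measurable C ->
    E (fun w => Z w * \1_C (X j w)) = c * E (fun w => \1_C (X j w)).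
  move=> mC; pose h' i := if i == j then \1_C else h i.
  have mC' i : measurable (if i == j then C else B i) by case: ifP.
  have h'E (i : 'I_n) : h' i = if (i < k)%N then g i else \1_(if i == j then C else B i).
    rewrite /h'; have [->|ij] := eqVneq i j; first by rewrite /= ltnn.
    rewrite hE ltnS leq_eqVlt; have -> // : (i == k :> nat) = false.
    by apply/negbTE; move: ij; rewrite -val_eqE.
  have h'j : h' j = \1_C by rewrite /h' eqxx.
  have := IH (ltnW kn) _ h' mC' h'E.
  rewrite [X in _ = X](bigD1 j)//= h'j => H.
  have {H} -> : c * E (fun w => \1_C (X j w)) = E (fun w => \prod_i h' i (X i w)).
    rewrite H mulrC; congr (_ * _); apply: eq_bigr => i ij.
    by rewrite /h' (negbTE ij).
  apply: eq_Rintegral => w _; rewrite [RHS](bigD1 j)//= h'j mulrC.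
  by congr (_ * _); apply: eq_bigr => i ij; rewrite /h' (negbTE ij).
have c0 : 0 <= c.
  apply: prodr_ge0 => i _; apply: Rintegral_ge0 => w _.
  by have /andP[] := h01 i (X i w).
rewrite [RHS](bigD1 j)//= hj -/c mulrC.
transitivity (E (fun w => Z w * g j (X j w))).
  by apply: eq_Rintegral => w _; rewrite (bigD1 j)//= hj mulrC.
have {}EI C : measurable C ->
    (\int[Pr]_w (Z w * \1_C (X j w))%:E = \int[Pr]_w (c * \1_C (X j w))%:E)%E.
  move=> mC.
  have mi : measurable_fun setT (fun w => \1_C (X j w) : R).
    by apply: (@mcomp (\1_C)); exact: measurable_indic.
  have i1 : Pr.-integrable setT (EFin \o (fun w => Z w * \1_C (X j w))).
    apply: unit_integrable; first exact: measurable_funM.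
    move=> w; have /andP[? ?] := Z01 w; have /andP[? ?] := indic_01 C (X j w).
    by rewrite mulr_ge0// mulr_ile1.
  have i2 : Pr.-integrable setT (EFin \o (fun w => \1_C (X j w) : R)).
    by apply: unit_integrable => // w; exact: indic_01.
  have := congr1 EFin (EI C mC); rewrite /E -RintegralZl// /Rintegral.
  rewrite fineK; last exact: (integrable_fin_num measurableT i1).
  by rewrite fineK//; exact: (integrable_fin_num measurableT (integrableZl measurableT c i2)).
have := @integral_weight_ext _ _ _ _ _ Pr Pr (X j) (X j) Z (cst c)
  (mX j) (mX j) mZ (measurable_cst c) (fun w => proj1 (andP (Z01 w))) (fun=> c0) EI
  (g j) (mg j) (fun x => proj1 (andP (g01 j x))).
move=> H; rewrite /E -RintegralZl//; first exact: (congr1 fine H).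
by apply: unit_integrable => //; exact: mcomp.
Qed.

End Independence.

Lemma cvg_scaleB (R : realType) (u v : nat -> R) (a b l m : R) :
  u n @[n --> \oo] --> l -> v n @[n --> \oo] --> m ->
  a * u n - b * v n @[n --> \oo] --> a * l - b * m.
Proof. by move=> ul vm; apply: cvgB; apply: cvgMr. Qed.

Lemma Rintegral_scaleB d (T : measurableType d) (R : realType)
    (mu : {measure set T -> \bar R}) (D : set T) (f g : T -> R) (a b : R) :
  mu.-integrable D (EFin \o f) -> mu.-integrable D (EFin \o g) -> measurable D ->
  Rintegral mu D (fun x => a * f x - b * g x) =
  a * Rintegral mu D f - b * Rintegral mu D g.
Proof.
move=> fi gi mD; rewrite -!RintegralZl// -RintegralB//.
- exact: (@integrableZl _ _ _ _ _ mD a _ fi).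
- exact: (@integrableZl _ _ _ _ _ mD b _ gi).
Qed.

(** To be used with [I = B(a, b)], [J1 = B(a, b+1)] and [J2 = B(a+1, b)], where [B] is the beta
    function. *)
Lemma mean_of_parts (R : realType) (a b I J1 J2 : R) : 0 < a -> 0 < b -> 0 < I ->
  a * J1 = b * J2 -> J1 + J2 = I -> I^-1 * J2 = a / (a + b).
Proof.
move=> a0 b0 I0 p s; have ab0 : a + b != 0 by rewrite gt_eqF// addr_gt0.
have -> : J2 = a * I / (a + b).
  apply: (canRL (mulfK ab0)); rewrite -s !mulrDr [J2 * b]mulrC -p.
  by rewrite [J2 * a]mulrC addrC.
by rewrite mulrA mulrCA mulVf ?mulr1// gt_eqF.
Qed.

(** * Beta densities, integration by parts and the beta mean *)

Section Beta.
Variable R : realType.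
Implicit Types a b x : R.
Local Notation mu := (@lebesgue_measure R).

Lemma beta_dens_ge0 a b x : 0 <= beta_dens a b x.
Proof. by rewrite mulr_ge0 ?powR_ge0. Qed.

Lemma measurable_beta_dens a b : measurable_fun setT (beta_dens a b).
Proof.
apply: measurable_funM; first exact: measurable_powR.
by apply: (measurableT_comp (measurable_powR _)); exact: measurable_funB.
Qed.

Lemma measurable_oo01 : measurable (@oo01 R).
Proof.
rewrite (_ : @oo01 R = `]0, 1[%classic); first exact: measurable_itv.
by apply/seteqP; split => x; rewrite /oo01 /= in_itv.
Qed.

Lemma beta_dens_split a b x : 0 < a -> 0 < b -> @oo01 R x ->
  beta_dens a (b + 1) x = (1 - x) * beta_dens a b x /\
  beta_dens (a + 1) b x = x * beta_dens a b x.
Proof.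
move=> a0 b0 /andP[x0 x1]; rewrite /beta_dens !addrK; split.
  by rewrite mulrCA mulr_powRB1// subr_ge0 ltW.
by rewrite mulrA mulr_powRB1// ltW.
Qed.

(** For [a, b > 0] it vanishes at 0 and 1, so integrating its derivative gives
    [a B(a, b+1) = b B(a+1, b)]. *)
Definition beta_prim a b x : R := x `^ a * (1 - x) `^ b.

Lemma is_derive_beta_prim a b x : 0 < x < 1 ->
  is_derive x 1 (beta_prim a b) (a * beta_dens a (b + 1) x - b * beta_dens (a + 1) b x).
Proof.
move=> /andP[x0 x1].
have d1 := is_derive1_powR a x0.
have x10 : 0 < 1 - x by rewrite subr_gt0.
have d2 : is_derive x 1 (fun y : R => 1 - y) (-1).
  by rewrite -[X in is_derive _ _ _ X]sub0r; apply: is_deriveB.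
have d3 := @is_derive1_comp R (fun y => y `^ b) (fun y => 1 - y) x _ _ (is_derive1_powR b x10) d2.
have := is_deriveM d1 d3; rewrite /GRing.scale /= => d4.
apply: (is_derive_eq d4); rewrite /beta_dens !addrK /=.
by ring.
Qed.

Lemma derivable_beta_dens a b x : 0 < x < 1 -> derivable (beta_dens a b) x 1.
Proof.
(* The density with parameters [a, b] is [beta_prim] with exponents [a - 1, b - 1]. *)
move=> x01; have h := is_derive_beta_prim (a - 1) (b - 1) x01.
exact: (@ex_derive _ _ _ _ _ _ _ h).
Qed.

(** The shift by 3 keeps [delta n] at most 1/3, so that [delta n < 1 - delta n] already for
    [n = 0]. *)
Let delta (n : nat) : R := n.+3%:R^-1.

Let delta_gt0 n : 0 < delta n. Proof. by rewrite invr_gt0. Qed.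

Let delta_lt n : delta n < 1 - delta n.
Proof.
have : delta n <= 3^-1 by rewrite lef_pV2 ?posrE// ler_nat.
by lra.
Qed.

Let cut n : set R := `[delta n, 1 - delta n]%classic.

Let cut01 n x : x \in `[delta n, 1 - delta n] -> 0 < x < 1.
Proof.
rewrite in_itv/= => /andP[h1 h2]; have := delta_gt0 n => h3.
by apply/andP; split; lra.
Qed.

Lemma integral_cut a b n :
  (\int[mu]_(x in cut n) (a * beta_dens a (b + 1) x - b * beta_dens (a + 1) b x)%:E =
  (beta_prim a b (1 - delta n))%:E - (beta_prim a b (delta n))%:E)%E.
Proof.
have dF x : x \in `[delta n, 1 - delta n] -> derivable (beta_prim a b) x 1.
  by move=> /cut01 x01; exact: (@ex_derive _ _ _ _ _ _ _ (is_derive_beta_prim a b x01)).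
have cF x : x \in `[delta n, 1 - delta n] -> {for x, continuous (beta_prim a b)}.
  by move=> xd; apply: differentiable_continuous; apply/derivable1_diffP; exact: dF.
apply: continuous_FTC2 => //.
- apply: derivable_within_continuous => x /cut01 x01.
  apply: derivableB; apply: derivableM => //; exact: derivable_beta_dens.
- split.
  + by move=> x xd; apply: dF; apply: subset_itv_oo_cc.
  + by apply: cvg_at_right_filter; apply: cF; rewrite in_itv/= lexx ltW.
  + by apply: cvg_at_left_filter; apply: cF; rewrite in_itv/= lexx ltW.
- move=> x /subset_itv_oo_cc/cut01 x01; rewrite derive1E.
  by have h := is_derive_beta_prim a b x01; rewrite derive_val.
Qed.

Let delta_cvg : delta n @[n --> \oo] --> (0 : R).
Proof.
apply: (@squeeze_cvgr _ _ _ _ (cst 0) (@harmonic R)).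
- apply: nearW => n; rewrite ltW//= /delta lef_pV2 ?posrE//.
  by rewrite ler_nat -addn2 leq_addr.
- exact: cvg_cst.
- exact: cvg_harmonic.
Qed.

Let powR_delta_cvg a : 0 < a -> delta n `^ a @[n --> \oo] --> (0 : R).
Proof.
by move=> a0; apply: ((cvg_at_rightP (fun y : R => y `^ a) 0 0).1 (powR_cvg0 a0)).
Qed.

Let powR_le1 a x : 0 < a -> 0 <= x <= 1 -> x `^ a <= 1.
Proof.
move=> a0 /andP[x0 x1]; have -> : 1 = 1 `^ a :> R by rewrite powR1.
by apply: ge0_ler_powR; rewrite ?nnegrE// ltW.
Qed.

Lemma beta_prim_cvg a b : 0 < a -> 0 < b ->
  beta_prim a b (1 - delta n) - beta_prim a b (delta n) @[n --> \oo] --> (0 : R).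
Proof.
move=> a0 b0; have d01 n : 0 <= delta n <= 1.
  by have := delta_gt0 n; have := delta_lt n => h1 h2; apply/andP; split; lra.
have d01' n : 0 <= 1 - delta n <= 1.
  by have /andP[h1 h2] := d01 n; apply/andP; split; lra.
rewrite -[X in _ --> X](subrr (0 : R)); apply: cvgB.
- apply: (@squeeze_cvgr _ _ _ _ (cst 0) (fun n => delta n `^ b)).
  + apply: nearW => n; rewrite /beta_prim mulr_ge0 ?powR_ge0//= subKr.
    by rewrite -[leRHS]mul1r ler_wpM2r ?powR_ge0// powR_le1.
  + exact: cvg_cst.
  + exact: powR_delta_cvg.
- apply: (@squeeze_cvgr _ _ _ _ (cst 0) (fun n => delta n `^ a)).
  + apply: nearW => n; rewrite /beta_prim mulr_ge0 ?powR_ge0//=.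
    by rewrite -[leRHS]mulr1 ler_wpM2l ?powR_ge0// powR_le1.
  + exact: cvg_cst.
  + exact: powR_delta_cvg.
Qed.

Let bigcup_cut : \bigcup_n cut n = @oo01 R.
Proof.
apply/seteqP; split => x; first by move=> [n _ /cut01].
move=> /andP[x0 x1]; pose y := Num.min x (1 - x).
have y0 : 0 < y by rewrite lt_min x0 subr_gt0.
have [N _ hN] := near_infty_natSinv_lt (PosNum y0).
exists N => //; rewrite /cut /= in_itv /=.
have h : delta N < y.
  apply: le_lt_trans (hN N (leqnn N)); rewrite lef_pV2 ?posrE//.
  by rewrite ler_nat -addn2 leq_addr.
by move: h; rewrite lt_min => /andP[h1 h2]; apply/andP; split; lra.
Qed.

Let mcut n : measurable (cut n). Proof. exact: measurable_itv. Qed.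

Let cut_cvg (f : R -> R) : measurable_fun setT f -> (forall x, 0 <= f x) ->
  mu.-integrable (@oo01 R) (EFin \o f) ->
  Rintegral mu (cut n) f @[n --> \oo] --> Rintegral mu (@oo01 R) f.
Proof.
move=> mf f0 fi; apply: fine_cvg; rewrite /Rintegral fineK; last first.
  by apply: integrable_fin_num => //; exact: measurable_oo01.
rewrite -bigcup_cut; apply: ge0_nondecreasing_set_cvg_integral => //.
- move=> n m nm; apply/subsetPset => x; rewrite /cut /= !in_itv/= => /andP[h1 h2].
  have : delta m <= delta n by rewrite lef_pV2 ?posrE// ler_nat.
  by move=> h; apply/andP; split; lra.
- by move=> n; apply/measurable_EFinP; exact: measurable_funTS.
- by move=> n x _; rewrite lee_fin.
Qed.

Section Parts.
Variables a b : R.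
Hypotheses (a0 : 0 < a) (b0 : 0 < b).
Hypothesis finB : (\int[mu]_(x in @oo01 R) (beta_dens a b x)%:E < +oo)%E.

Lemma integrable_beta_dens : mu.-integrable (@oo01 R) (EFin \o beta_dens a b).
Proof.
apply/integrableP; split.
  by apply/measurable_EFinP; apply: measurable_funTS; exact: measurable_beta_dens.
by under eq_integral do rewrite /= ger0_norm ?beta_dens_ge0//.
Qed.

Let le_integrable_beta_dens (f : R -> R) : measurable_fun setT f ->
  (forall x, @oo01 R x -> 0 <= f x <= beta_dens a b x) ->
  mu.-integrable (@oo01 R) (EFin \o f).
Proof.
move=> mf fd; apply: (@le_integrable _ _ _ mu _ measurable_oo01 (EFin \o f)
  (EFin \o beta_dens a b)); last exact: integrable_beta_dens.
  by apply/measurable_EFinP; exact: measurable_funTS.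
move=> x x01; have /andP[f0 fle] := fd x x01.
by rewrite /= lee_fin !ger0_norm// beta_dens_ge0.
Qed.

Lemma integrable_beta_densl :
  mu.-integrable (@oo01 R) (EFin \o beta_dens (a + 1) b).
Proof.
apply: le_integrable_beta_dens; first exact: measurable_beta_dens.
move=> x x01; have [_ ->] := beta_dens_split a0 b0 x01.
have /andP[x0 x1] := x01.
rewrite mulr_ge0 ?beta_dens_ge0 ?(ltW x0)//= -[leRHS]mul1r.
by rewrite ler_wpM2r ?beta_dens_ge0// ltW.
Qed.

Lemma integrable_beta_densr :
  mu.-integrable (@oo01 R) (EFin \o beta_dens a (b + 1)).
Proof.
apply: le_integrable_beta_dens; first exact: measurable_beta_dens.
move=> x x01; have [-> _] := beta_dens_split a0 b0 x01.
have /andP[x0 x1] := x01.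
rewrite mulr_ge0 ?beta_dens_ge0 ?subr_ge0 ?(ltW x1)//= -[leRHS]mul1r.
by rewrite ler_wpM2r ?beta_dens_ge0// lerBlDr lerDl ltW.
Qed.

(** The densities may be unbounded near 0 and 1, so the fundamental theorem of calculus is applied
    on [cut n]. As [n] grows the integrals converge monotonically and the boundary terms tend to
    0. *)
Lemma beta_parts :
  a * Rintegral mu (@oo01 R) (beta_dens a (b + 1)) =
  b * Rintegral mu (@oo01 R) (beta_dens (a + 1) b).
Proof.
apply/eqP; rewrite -subr_eq0; apply/eqP.
have c1 := cut_cvg (measurable_beta_dens _ _) (beta_dens_ge0 _ _) integrable_beta_densr.
have c2 := cut_cvg (measurable_beta_dens _ _) (beta_dens_ge0 _ _) integrable_beta_densl.
have c : (fun n => a * Rintegral mu (cut n) (beta_dens a (b + 1)) -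
    b * Rintegral mu (cut n) (beta_dens (a + 1) b)) @ \oo -->
    a * Rintegral mu (@oo01 R) (beta_dens a (b + 1)) -
    b * Rintegral mu (@oo01 R) (beta_dens (a + 1) b).
  exact: cvg_scaleB c1 c2.
apply: (cvg_unique _ c _) => //.
suff -> : (fun n => a * Rintegral mu (cut n) (beta_dens a (b + 1)) -
    b * Rintegral mu (cut n) (beta_dens (a + 1) b)) =
    (fun n => beta_prim a b (1 - delta n) - beta_prim a b (delta n)).
  exact: beta_prim_cvg.
apply/funext => n; have sub : cut n `<=` @oo01 R by move=> x /cut01.
have i1 : mu.-integrable (cut n) (EFin \o beta_dens a (b + 1)).
  by apply: (@integrableS _ _ _ mu (@oo01 R));
    [exact: measurable_oo01|exact: mcut|exact: sub|exact: integrable_beta_densr].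
have i2 : mu.-integrable (cut n) (EFin \o beta_dens (a + 1) b).
  by apply: (@integrableS _ _ _ mu (@oo01 R));
    [exact: measurable_oo01|exact: mcut|exact: sub|exact: integrable_beta_densl].
rewrite -(Rintegral_scaleB a b i1 i2); last exact: mcut.
by rewrite /Rintegral integral_cut.
Qed.

Lemma beta_sum :
  Rintegral mu (@oo01 R) (beta_dens a (b + 1)) +
  Rintegral mu (@oo01 R) (beta_dens (a + 1) b) =
  Rintegral mu (@oo01 R) (beta_dens a b).
Proof.
rewrite -RintegralD//; last 3 first.
- exact: measurable_oo01.
- exact: integrable_beta_densr.
- exact: integrable_beta_densl.
apply: eq_Rintegral => x; rewrite inE => x01.
have [h1 h2] := beta_dens_split a0 b0 x01.
rewrite -[LHS]/(beta_dens a (b + 1) x + beta_dens (a + 1) b x) h1 h2.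
by rewrite -mulrDl subrK mul1r.
Qed.

End Parts.

(* [V e] lies in (0,1) only almost surely; clipping makes the masses an additive tree everywhere. *)
Definition clip (x : R) : R := x * \1_(`[0, 1]%classic : set R) x.

Lemma clip01 x : 0 <= clip x <= 1.
Proof.
rewrite /clip indicE; have [|] := boolP (x \in _); last by rewrite mulr0 lexx ler01.
by rewrite inE/= in_itv/= mulr1.
Qed.

Lemma clip_id x : 0 <= x <= 1 -> clip x = x.
Proof. by move=> x01; rewrite /clip indicE mem_set ?mulr1//= in_itv. Qed.

Lemma measurable_clip : measurable_fun setT clip.
Proof.
apply: measurable_funM; first exact: measurable_id.
by apply: measurable_indic; exact: measurable_itv.
Qed.

Section Mean.
Context d (Omega : measurableType d) (Pr : probability Omega R) (V : Omega -> R).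
Variables a b : R.
Hypotheses (a0 : 0 < a) (b0 : 0 < b) (mV : measurable_fun setT V).
Hypothesis lawV : forall B, measurable B -> Pr (V @^-1` B) = beta_law a b B.

(* [fine +oo = 0] and [0^-1 = 0]: a divergent or null normalization would give [beta_law] total
   mass 0, so the convergence of the beta integral follows from [Pr] having mass 1. *)
Lemma beta_law_normalized :
  (\int[mu]_(x in @oo01 R) (beta_dens a b x)%:E < +oo)%E /\
  0 < Rintegral mu (@oo01 R) (beta_dens a b).
Proof.
have I0 : (0 <= \int[mu]_(x in @oo01 R) (beta_dens a b x)%:E)%E.
  by apply: integral_ge0 => x _; rewrite lee_fin beta_dens_ge0.
have := lawV measurableT; rewrite /beta_law setTI preimage_setT probability_setT.
rewrite /Rintegral; move: I0.
case: (\int[mu]_(x in @oo01 R) (beta_dens a b x)%:E)%E => [r| |] //=.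
- move=> r0 h; split; first by rewrite ltry.
  rewrite lt_neqAle -lee_fin r0 andbT; apply/eqP => r_eq.
  by move: h; rewrite -r_eq -EFinM mul0r => /eqP; rewrite eqe oner_eq0.
- by move=> _; rewrite invr0 mule0 => /eqP; rewrite eqe oner_eq0.
Qed.

Lemma beta_as_01 : Pr [set w | 0 < V w < 1] = 1%E.
Proof.
have [fin I0] := beta_law_normalized.
rewrite (_ : [set w | _] = V @^-1` @oo01 R)// lawV; last exact: measurable_oo01.
rewrite /beta_law setIid; move: I0; rewrite /Rintegral => I0.
rewrite -[X in (X * _)%E]fineK; last first.
  by apply: integrable_fin_num; [exact: measurable_oo01|exact: integrable_beta_dens].
by rewrite -EFinM divff// gt_eqF.
Qed.

(** The law of [V] has density [Z], and [x] times the beta density for [a, b] is the one for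
    [a + 1, b]; [beta_parts] and [beta_sum] determine the ratio of the two integrals. *)
Lemma beta_mean : Rintegral Pr setT (clip \o V) = a / (a + b).
Proof.
have [fin I0] := beta_law_normalized.
pose I := Rintegral mu (@oo01 R) (beta_dens a b).
pose c := I^-1; have c0 : 0 <= c by rewrite invr_ge0 ltW.
pose Z x := c * (beta_dens a b x * \1_(@oo01 R) x).
have mo := measurable_oo01.
have md := measurable_beta_dens a b.
have mZ : measurable_fun setT Z.
  by apply: measurable_funM => //; apply: measurable_funM => //; exact: measurable_indic.
have Z0 x : 0 <= Z x.
  by rewrite /Z mulr_ge0// mulr_ge0 ?beta_dens_ge0//; have /andP[] := indic_01 (@oo01 R) x.
have ZI (f : R -> R) : measurable_fun setT f -> (forall x, 0 <= f x) ->
    (\int[mu]_x (Z x * f x)%:E =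
     c%:E * \int[mu]_(x in @oo01 R) (beta_dens a b x * f x)%:E)%E.
  move=> mf f0.
  rewrite [in RHS]integral_mkcond -ge0_integralZl//.
  - apply: eq_integral => x _; rewrite patchE /Z indicE.
    by case: ifPn => _; rewrite ?mulr1 ?mulr0 ?mul0r -?EFinM -?mulrA ?mulr0 ?mul0r ?mule0.
  - apply/(measurable_restrictT _ mo); apply/measurable_EFinP; apply: measurable_funTS.
    exact: measurable_funM.
  - by move=> x _; rewrite patchE; case: ifP => // _; rewrite lee_fin mulr_ge0 ?beta_dens_ge0.
have EI (B : set R) : measurable B ->
    (\int[Pr]_w (1 * \1_B (V w))%:E = \int[mu]_x (Z x * \1_B x)%:E)%E.
  move=> mB; rewrite ZI; [|exact: measurable_indic|by move=> x; have /andP[] := indic_01 B x].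
  under eq_integral do rewrite mul1r.
  have mVB : measurable (V @^-1` B) by rewrite -[X in measurable X]setTI; exact: mV.
  have -> : (\int[Pr]_w (\1_B (V w))%:E = Pr (V @^-1` B))%E.
    by rewrite -[LHS]/(\int[Pr]_w (\1_(V @^-1` B) w)%:E)%E integral_indic// setIT.
  rewrite lawV//.
  rewrite /beta_law muleC; congr (_ * _)%E.
  rewrite setIC integral_mkcondr; apply: eq_integral => x _.
  by rewrite patchE indicE; case: ifP; rewrite ?mulr1 ?mulr0.
have H : (\int[Pr]_w (cst 1 w * clip (V w))%:E = \int[mu]_x (Z x * clip (id x))%:E)%E.
  apply: (@integral_weight_ext _ _ _ _ R Pr mu V id (cst 1) Z).
  - exact: mV.
  - by move=> _ B mB; rewrite setTI.
  - exact: measurable_cst.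
  - exact: mZ.
  - by move=> t; exact: ler01.
  - exact: Z0.
  - exact: EI.
  - exact: measurable_clip.
  - by move=> x; have /andP[] := clip01 x.
move: H; rewrite ZI; [|exact: measurable_clip|by move=> x; have /andP[] := clip01 x].
move=> H; rewrite /Rintegral.
rewrite (_ : (\int[Pr]_x ((clip \o V) x)%:E =
    c%:E * \int[mu]_(x in @oo01 R) (beta_dens (a + 1) b x)%:E)%E).
  have fi : (\int[mu]_(x in @oo01 R) (beta_dens (a + 1) b x)%:E)%E \is a fin_num.
    by apply: integrable_fin_num; [exact: mo|exact: integrable_beta_densl].
  rewrite fineM//= -/(Rintegral _ _ _).
  have p := beta_parts a0 b0 fin; have s := beta_sum a0 b0 fin.
  exact: (mean_of_parts a0 b0 I0 p s).
transitivity (\int[Pr]_w (cst 1 w * clip (V w))%:E)%E.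
  by apply: eq_integral => w _; rewrite /= mul1r.
rewrite H; congr (_ * _)%E.
apply: eq_integral => x; rewrite inE => x01.
have [_ ->] := beta_dens_split a0 b0 x01; have /andP[x0 x1] := x01.
have xc : clip x = x by apply: clip_id; apply/andP; split; exact: ltW.
by rewrite xc mulrC.
Qed.

End Mean.
End Beta.

(** * Polya trees *)

Lemma probability_setC0 d (T : measurableType d) (R : realType)
    (Pr : probability T R) (A : set T) :
  measurable A -> Pr A = 1%E -> Pr (~` A) = 0%E.
Proof. by move=> mA A1; rewrite probability_setC// A1 subee. Qed.

Lemma expectation_cst d (T : measurableType d) (R : realType)
    (Pr : probability T R) (c : R) : Rintegral Pr setT (fun=> c) = c.
Proof.
rewrite Rintegral_cst// (_ : fine _ = 1) ?mulr1//.
exact: (congr1 fine (probability_setT Pr)).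
Qed.

Lemma probability_eq_on d (T : measurableType d) (R : realType)
    (Pr : probability T R) (A B N : set T) :
  measurable A -> measurable B -> measurable N -> Pr N = 1%E ->
  A `&` N = B `&` N -> Pr A = Pr B.
Proof.
move=> mA mB mN N1 AB.
have N0 : Pr (~` N) = 0%E by exact: probability_setC0.
have H C : measurable C -> Pr C = Pr (C `&` N).
  move=> mC; apply/eqP; rewrite eq_le; apply/andP; split; last first.
    by apply: le_measure; rewrite ?inE//; exact: measurableI.
  have mCN : measurable (C `&` N) by exact: measurableI.
  have mNc : measurable (~` N) by exact: measurableC.
  apply: (@le_trans _ _ (Pr ((C `&` N) `|` ~` N))).
    apply: le_measure; rewrite ?inE//; first exact: measurableU.
    by move=> x Cx; have [Nx|nN] := pselect (N x); [left|right].
  apply: (le_trans (measureU2 _ mCN mNc)).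
  by rewrite [X in (_ + X)%E](_ : _ = 0%E) ?adde0//; exact: N0.
by rewrite H// AB -H.
Qed.

Lemma probability_bigcap1 d (T : measurableType d) (R : realType)
    (Pr : probability T R) (I : countType) (F : I -> set T) :
  (forall i, measurable (F i)) -> (forall i, Pr (F i) = 1%E) ->
  Pr (\bigcap_i F i) = 1%E.
Proof.
move=> mF F1; have mI : measurable (\bigcap_i F i) by exact: measurable_bigcap_count.
rewrite -[X in Pr X]setCK probability_setC; last exact: measurableC.
suff -> : Pr (~` \bigcap_i F i) = 0%E by rewrite sube0.
apply/eqP; rewrite -measure_le0.
pose G n := if @choice.pickle_inv I n is Some i then ~` F i else set0.
apply: (@measure_cover_le _ _ _ Pr _ G) => //.
- by move=> n; rewrite /G; case: pickle_inv => // i; exact: measurableC.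
- exact: measurableC.
- rewrite setC_bigcap => x [i _ nF]; exists (choice.pickle i) => //.
  by rewrite /G pickleK_inv.
- move=> n; rewrite mul0r /G; case: pickle_inv => [i|]; last by rewrite measure0.
  by rewrite [leLHS](_ : _ = 0%E)//; exact: probability_setC0.
Qed.

(** * Masses as products of branching factors *)

Section Mass.
Context (R : realType) (Omega : Type).
Implicit Types (W : seq bool -> Omega -> R) (e : seq bool).

Definition factor W e (b : bool) (w : Omega) : R := if b then 1 - W e w else W e w.

(** [massA] reads a string from its first bit, whereas trees grow at the last one; induction with a
    general prefix reconciles the two orders. *)
Lemma mass_rcons W e b w : mass W (rcons e b) w = mass W e w * factor W e b w.
Proof.
rewrite /mass; suff H pre : massA W pre (rcons e b) w =
    massA W pre e w * factor W (pre ++ e) b w by exact: H.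
elim: e pre => [|c e IH] pre /=; first by rewrite cats0 mulr1 mul1r.
by rewrite IH cat_rcons mulrA.
Qed.

Lemma mass_prod W e w :
  mass W e w = \prod_(i < size e) factor W (take i e) (nth false e i) w.
Proof.
elim/last_ind: e => [|e b IH]; first by rewrite /mass /= big_ord0.
rewrite mass_rcons size_rcons big_ord_recr /= IH; congr (_ * _).
  apply: eq_bigr => i _; rewrite nth_rcons ltn_ord; congr factor.
  by rewrite -cats1 takel_cat// ltnW.
by rewrite nth_rcons ltnn eqxx -cats1 take_size_cat.
Qed.

Lemma factor01 W e b w : 0 <= W e w <= 1 -> 0 <= factor W e b w <= 1.
Proof. by move=> /andP[h1 h2]; rewrite /factor; case: b; apply/andP; split; lra. Qed.

Lemma tree_mass W w : (forall e, 0 <= W e w <= 1) -> tree (fun e => mass W e w).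
Proof.
move=> W01; split => // e; split.
  rewrite mass_prod prodr_ge0// => i _.
  by have /andP[] := factor01 (nth false e i) (W01 (take i e)).
by rewrite !mass_rcons -mulrDr /factor subrKC mulr1.
Qed.

Lemma mass_le1 W e w : (forall e, 0 <= W e w <= 1) -> 0 <= mass W e w <= 1.
Proof. by move=> W01; rewrite mass_prod; apply: prod_01 => i; exact: factor01. Qed.

End Mass.

(** * Mean masses and necessity of the product condition *)

Section PolyaTree.
Context (R : realType) (beta : seq bool -> R)
  (d : measure_display) (Omega : measurableType d) (Pr : probability Omega R)
  (V : seq bool -> Omega -> R).
Hypothesis beta_gt0 : forall e : seq bool, e != [::] -> 0 < beta e.
Hypothesis mV : forall e, measurable_fun setT (V e).
Hypothesis indepV : mutually_independent Pr V.
Hypothesis lawV : forall e B, measurable B ->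
  Pr (V e @^-1` B) = beta_law (beta (rcons e false)) (beta (rcons e true)) B.

Let clipV e w := clip (V e w).

Let clipV01 e w : 0 <= clipV e w <= 1. Proof. exact: clip01. Qed.

Let beta_rcons_gt0 e b : 0 < beta (rcons e b).
Proof. by apply: beta_gt0; case: e. Qed.

(** The mean of [V e]; along the strings [e 0^m] these are the factors of the product in the
    theorem. *)
Definition branch e : R :=
  beta (rcons e false) / (beta (rcons e false) + beta (rcons e true)).

Lemma branch01 e : 0 < branch e < 1.
Proof.
have p0 := beta_rcons_gt0 e false; have p1 := beta_rcons_gt0 e true.
rewrite /branch divr_gt0 ?addr_gt0//= ltr_pdivrMr ?addr_gt0// mul1r.
by rewrite ltrDl.
Qed.

Definition branch_factor e (b : bool) := if b then 1 - branch e else branch e.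

Lemma measurable_mass (W : seq bool -> Omega -> R) e :
  (forall e, measurable_fun setT (W e)) -> measurable_fun setT (mass W e).
Proof.
move=> mW; rewrite (_ : mass W e =
    fun w => \prod_(i < size e) factor W (take i e) (nth false e i) w).
  apply: measurable_prod => i _; rewrite /factor; case: nth; last exact: mW.
  by apply: measurable_funB => //; exact: measurable_cst.
by apply/funext => w; rewrite mass_prod.
Qed.

Let mclipV e : measurable_fun setT (clipV e).
Proof. by apply: (measurableT_comp (@measurable_clip R)). Qed.

Let mmass e : measurable_fun setT (mass clipV e).
Proof. exact: measurable_mass. Qed.

(** On this event, of probability one, clipping changes nothing, so the clipped masses are those
    built from [V]. *)
Let V_open : set Omega := \bigcap_e [set w | 0 < V e w < 1].

Let mV_open1 e : measurable [set w | 0 < V e w < 1].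
Proof.
rewrite (_ : [set w | _] = V e @^-1` @oo01 R)// -[X in measurable X]setTI.
by apply: mV => //; exact: measurable_oo01.
Qed.

Let mV_open : measurable V_open.
Proof. by apply: measurable_bigcap_count => e _; exact: mV_open1. Qed.

Let Pr_V_open : Pr V_open = 1%E.
Proof.
apply: probability_bigcap1 => // e.
exact: (beta_as_01 (@lawV e)).
Qed.

Let mass_clip w e : V_open w -> mass clipV e w = mass V e w.
Proof.
move=> Vw; rewrite !mass_prod; apply: eq_bigr => i _; rewrite /factor /clipV.
rewrite clip_id//; have /andP[h1 h2] := Vw (take i e) I.
by apply/andP; split; exact: ltW.
Qed.

Lemma mean_mass e : Rintegral Pr setT (mass clipV e) =
  \prod_(i < size e) branch_factor (take i e) (nth false e i).
Proof.
pose g (i : 'I_(size e)) (x : R) := if nth false e i then 1 - clip x else clip x.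
have mc := @measurable_clip R.
have mg i : measurable_fun setT (g i).
  rewrite /g; case: nth => //.
  by apply: measurable_funB => //; exact: measurable_cst.
have g01 i x : 0 <= g i x <= 1.
  rewrite /g; have /andP[h1 h2] := clip01 x; case: nth; apply/andP; split; lra.
(* Prefixes of different lengths differ, so the variables along one branch have distinct indices and
   independence applies. *)
have inj : injective (fun i : 'I_(size e) => take i e).
  move=> i j /(congr1 size); rewrite !size_takel ?(ltnW (ltn_ord _))// => ij.
  exact: val_inj.
have := @expectation_prod _ _ _ Pr _ (fun i => V (take i e)) (fun i => mV (take i e))
  (@indepV _ _ inj) g mg g01.
rewrite (_ : (fun w => \prod_i g i (V (take i e) w)) = mass clipV e); last first.
  by apply/funext => w; rewrite mass_prod; apply: eq_bigr => i _; rewrite /factor /g /clipV.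
move=> ->; apply: eq_bigr => i _.
have E1 := beta_mean (beta_rcons_gt0 (take i e) false) (beta_rcons_gt0 (take i e) true)
  (mV (take i e)) (@lawV (take i e)).
rewrite /g /branch_factor; case: nth => //.
rewrite RintegralB//.
- by rewrite [X in _ - X]E1 expectation_cst.
- exact: finite_measure_integrable_cst.
- by apply: unit_integrable => [|w]; [exact: mclipV|exact: clipV01].
Qed.

Lemma mean_mass_nseq e n : Rintegral Pr setT (mass clipV (e ++ nseq n false)) =
  Rintegral Pr setT (mass clipV e) * \prod_(m < n) branch (e ++ nseq m false).
Proof.
elim: n => [|n IH]; first by rewrite cats0 big_ord0 mulr1.
have -> : e ++ nseq n.+1 false = rcons (e ++ nseq n false) false.
  by rewrite -addn1 nseqD catA cats1.
rewrite big_ord_recr /= mulrA -IH.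
rewrite !mean_mass size_rcons big_ord_recr /=; congr (_ * _).
  apply: eq_bigr => i _; rewrite nth_rcons ltn_ord; congr branch_factor.
  by rewrite -cats1 takel_cat// ltnW.
by rewrite nth_rcons ltnn eqxx -cats1 take_size_cat.
Qed.

Lemma mean_mass_gt0 e : 0 < Rintegral Pr setT (mass clipV e).
Proof.
rewrite mean_mass; apply: prodr_gt0 => i _; rewrite /branch_factor.
by have /andP[h1 h2] := branch01 (take i e); case: nth; lra.
Qed.

Lemma branch_nseq e m : branch (e ++ nseq m false) =
  beta (e ++ nseq m.+1 false) /
    (beta (e ++ nseq m.+1 false) + beta (e ++ rcons (nseq m false) true)).
Proof.
rewrite /branch !rcons_cat (_ : rcons (nseq m false) false = nseq m.+1 false)//.
by rewrite -cats1 -(nseqD m 1) addn1.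
Qed.

Lemma branch_cvg0 e : (\prod_(m < n) branch (e ++ nseq m false) @[n --> \oo] --> (0 : R)) <->
  (Rintegral Pr setT (mass clipV (e ++ nseq n false)) @[n --> \oo] --> (0 : R)).
Proof.
pose c := Rintegral Pr setT (mass clipV e).
have c0 : c != 0 by rewrite gt_eqF// mean_mass_gt0.
rewrite (_ : (fun n => Rintegral _ _ _) =
    (fun n => c * \prod_(m < n) branch (e ++ nseq m false))); last first.
  by apply/funext => n; rewrite mean_mass_nseq.
split=> h; first by rewrite -(mulr0 c); exact: cvgMr.
rewrite (_ : (fun n => \prod_(m < n) _) =
    (fun n => c^-1 * (c * \prod_(m < n) branch (e ++ nseq m false)))).
  by rewrite -(mulr0 c^-1); exact: cvgMr.
by apply/funext => n; rewrite mulKf.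
Qed.

Let ev01 (P : M1 R) e : 0 <= ev P e <= 1.
Proof.
rewrite /ev fine_ge0//= -fine1 fine_le//.
  by apply: fin_num_measure; exact: measurable_dyad.
by apply: probability_le1; exact: measurable_dyad.
Qed.

Let measurable_mass_level (W : seq bool -> Omega -> R) m (B : seq bool -> set R) :
  (forall e, measurable_fun setT (W e)) -> (forall e, measurable (B e)) ->
  measurable [set w | forall e, size e = m -> B e (mass W e w)].
Proof.
move=> mW mB; rewrite (_ : [set w | _] =
   \bigcap_(e in [set e | size e = m]) (mass W e @^-1` B e)).
  apply: measurable_bigcap_count => e _; rewrite -[X in measurable X]setTI.
  by apply: measurable_mass.
by apply/seteqP; split => w h e em; exact: h.
Qed.

Lemma projects_mean (Q : probability (M1B R) R) e : projects_to Pr V Q (size e) ->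
  Rintegral Q setT (fun P => ev P e) = Rintegral Pr setT (mass clipV e).
Proof.
move=> pQ.
have eqB (B : set R) : measurable B ->
    Q [set P : M1B R | B (ev P e)] = Pr [set w | B (mass clipV e w)].
  (* A rectangle constraining only the string [e] extracts the law of a single mass. *)
  move=> mB; pose C f := if f == e then B else setT.
  have mC f : measurable (C f) by rewrite /C; case: ifP.
  have CE (x : seq bool -> R) : (forall f, size f = size e -> C f (x f)) <-> B (x e).
    split=> [/(_ e erefl)|Bx f _]; first by rewrite /C eqxx.
    by rewrite /C; case: eqP => [->|].
  have := pQ C mC.
  rewrite (_ : [set P : M1B R | _] = [set P : M1B R | B (ev P e)]); last first.
    by apply/seteqP; split => P /=; [exact: (CE (ev P)).1|exact: (CE (ev P)).2].
  move=> ->; apply: (@probability_eq_on _ _ _ Pr _ _ V_open) => //.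
  - exact: measurable_mass_level.
  - by rewrite -[X in measurable X]setTI; apply: mmass.
  apply/seteqP; split => w /= [h Vw]; split => //.
    by rewrite mass_clip//; exact: (CE (fun e => mass V e w)).1.
  by apply: (CE (fun e => mass V e w)).2; rewrite -mass_clip.
have mev := @measurable_ev R e.
(* [clip] is the identity on masses and nonnegative on the whole line, as the transfer of integrals
   requires. *)
have H : (\int[Q]_P (cst 1 P * clip (ev P e))%:E =
    \int[Pr]_w (cst 1 w * clip (mass clipV e w))%:E)%E.
  apply: integral_weight_ext => //.
  - move=> B mB.
    have m1 : measurable [set P : M1B R | B (ev P e)].
      by rewrite -[X in measurable X]setTI; exact: mev.
    have m2 : measurable [set w | B (mass clipV e w)].
      by rewrite -[X in measurable X]setTI; exact: mmass.
    transitivity (Q [set P : M1B R | B (ev P e)]).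
      under eq_integral do rewrite mul1r.
      rewrite -[LHS]/(\int[Q]_P (\1_([set P : M1B R | B (ev P e)]) P)%:E)%E.
      by rewrite integral_indic// setIT.
    rewrite eqB//; under [RHS]eq_integral do rewrite mul1r.
    rewrite -[RHS]/(\int[Pr]_w (\1_([set w | B (mass clipV e w)]) w)%:E)%E.
    by rewrite integral_indic// setIT.
  - exact: measurable_clip.
  - by move=> x; have /andP[] := clip01 x.
rewrite /Rintegral; congr fine.
transitivity (\int[Q]_P (cst 1 P * clip (ev P e))%:E)%E.
  by apply: eq_integral => P _; rewrite mul1r clip_id// ev01.
rewrite H; apply: eq_integral => w _; rewrite mul1r clip_id//.
exact: mass_le1.
Qed.

(** The masses of [e 0^n] are at most 1 and tend to 0 for every [P], so their means under [Q] tend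
    to 0; these equal the means of the Polya tree masses. *)
Lemma projects_branch_cvg0 (Q : probability (M1B R) R) :
  (forall m, projects_to Pr V Q m) ->
  forall e, \prod_(m < n) branch (e ++ nseq m false) @[n --> \oo] --> (0 : R).
Proof.
move=> pQ e; apply/branch_cvg0.
rewrite (_ : (fun n => Rintegral _ _ _) =
    (fun n => Rintegral Q setT (fun P => ev P (e ++ nseq n false)))); last first.
  by apply/funext => n; rewrite (projects_mean (pQ _)).
have [_] := @bounded_cvg_Rintegral _ _ _ Q setT 1
  (fun n P => ev P (e ++ nseq n false)) (fun=> 0) measurableT
  (fun n => @measurable_ev R _) (fun P _ => ev_cvg P e)
  (fun n P _ => ltac:(have /andP[h1 h2] := ev01 P (e ++ nseq n false); rewrite ger0_norm//)).
by rewrite /Rintegral integral0.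
Qed.

(** * Construction of a random measure from the clipped tree *)

Section Construction.
Hypothesis branch0 :
  forall e, \prod_(m < n) branch (e ++ nseq m false) @[n --> \oo] --> (0 : R).

Let small_event e k n : set Omega :=
  [set w | mass clipV (e ++ nseq n false) w <= k.+1%:R^-1].

Let msmall e k n : measurable (small_event e k n).
Proof.
rewrite /small_event -[X in measurable X]setTI.
rewrite (_ : [set w | _] = mass clipV (e ++ nseq n false) @^-1` `]-oo, k.+1%:R^-1]%classic).
  by apply: mmass.
by apply/seteqP; split => w /=; rewrite in_itv.
Qed.

Let good_event : set Omega :=
  \bigcap_ek \bigcup_n small_event ek.1 ek.2 n.

Let mgood_event : measurable good_event.
Proof.
apply: (@measurable_bigcap_count _ _ (seq bool * nat)%type) => ek _.
by apply: bigcupT_measurable => n; exact: msmall.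
Qed.

Let markov_mass e (c : R) : 0 < c ->
  c * fine (Pr [set w | c < mass clipV e w]) <= Rintegral Pr setT (mass clipV e).
Proof.
move=> c0; pose A := [set w | c < mass clipV e w].
have mA : measurable A.
  rewrite -[X in measurable X]setTI (_ : A = mass clipV e @^-1` `]c, +oo[%classic).
    by apply: mmass.
  by apply/seteqP; split => w /=; rewrite in_itv/= andbT.
have iA : Pr.-integrable setT (EFin \o (\1_A : Omega -> R)) by exact: integrable_indic.
have -> : fine (Pr A) = Rintegral Pr setT \1_A.
  by rewrite /Rintegral integral_indic// setIT.
rewrite -RintegralZl//; apply: le_Rintegral.
- exact: measurableT.
- exact: (@integrableZl _ _ _ _ _ measurableT c _ iA).
- by apply: unit_integrable; [exact: mmass|move=> w; exact: mass_le1].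
- move=> w _; rewrite -[leRHS]/(mass clipV e w) -[leLHS]/(c * \1_A w) indicE.
  have [|_] := boolP (w \in A).
    by rewrite inE mulr1 => /ltW.
  by rewrite mulr0; have /andP[] := @mass_le1 _ _ clipV e w (clipV01 ^~ w).
Qed.

(** On the complement for a pair [(e, k)] the masses of all [e 0^n] exceed [1/(k+1)]; Markov's
    inequality bounds its probability by [k + 1] times means that tend to 0. *)
Let Pr_good_event : Pr good_event = 1%E.
Proof.
apply: (@probability_bigcap1 _ _ _ Pr (seq bool * nat)%type) => -[e k] /=.
  by apply: bigcupT_measurable => n; exact: msmall.
have mU : measurable (\bigcup_n small_event e k n).
  by apply: bigcupT_measurable => n; exact: msmall.
rewrite -[X in Pr X]setCK probability_setC; last exact: measurableC.
suff -> : Pr (~` \bigcup_n small_event e k n) = 0%E by rewrite sube0.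
set A := ~` _; have mA : measurable A by exact: measurableC.
have k0 : 0 < k.+1%:R^-1 :> R by rewrite invr_gt0.
have le n : k.+1%:R^-1 * fine (Pr A) <= Rintegral Pr setT (mass clipV (e ++ nseq n false)).
  apply: le_trans (markov_mass _ k0); apply: ler_wpM2l; first exact: ltW.
  have mB : measurable [set w | k.+1%:R^-1 < mass clipV (e ++ nseq n false) w].
    rewrite (_ : [set w | _] = ~` small_event e k n); first exact: measurableC.
    by apply/seteqP; split => w; rewrite /small_event /= ltNge => /negP.
  apply: fine_le; rewrite ?fin_num_measure//.
  apply: le_measure; rewrite ?inE// => w nw /=; rewrite ltNge; apply/negP => h.
  by apply: nw; exists n.
have : k.+1%:R^-1 * fine (Pr A) <= 0.
  have cv := (branch_cvg0 e).1 (branch0 e).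
  rewrite -(cvg_lim _ cv)//; apply: limr_ge; first by apply/cvg_ex; eexists; exact: cv.
  by apply: nearW => n; exact: le.
rewrite pmulr_rle0// => h.
apply: etrans (esym (fineK (fin_num_measure Pr A mA))) _; congr EFin.
by apply: le_anti; rewrite h fine_ge0.
Qed.

(** Off the good event the tree is replaced by that of the default measure, the Dirac mass at 1, so
    that every [Psi w] comes from a measure; indicators keep it visibly measurable. *)
Let Psi (w : Omega) (e : seq bool) : R :=
  mass clipV e w * \1_good_event w + ev (point : M1 R) e * \1_(~` good_event) w.

Let Psi_mass w : good_event w -> Psi w = mass clipV ^~ w.
Proof.
move=> gw; apply/funext => e.
by rewrite /Psi !indicE mem_set// memNset ?mulr1 ?mulr0 ?addr0//; apply.
Qed.

Let good_Psi w : good (Psi w).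
Proof.
have [gw|ngw] := pselect (good_event w).
  rewrite Psi_mass//; split; first by apply: tree_mass.
  by move=> e k; have [n _] := gw (e, k) I; exists n.
suff -> : Psi w = ev (point : M1 R) by exact: good_ev.
apply/funext => e.
by rewrite /Psi !indicE memNset// mem_set// mulr1 mulr0 add0r.
Qed.

Let mPsi e : measurable_fun setT (fun w => Psi w e).
Proof.
apply: measurable_funD; apply: measurable_funM; first exact: mmass.
- exact: measurable_indic.
- exact: measurable_cst.
- by apply: measurable_indic; exact: measurableC.
Qed.

Lemma polya_tree_exists : exists Q : probability (M1B R) R,
  forall m, projects_to Pr V Q m.
Proof.
have /choice[Phi PhiE] : forall w, exists P : M1 R, ev P = Psi w.
  by move=> w; exact: M1_of_tree.
have mPhi : measurable_fun setT (Phi : Omega -> M1B R).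
  (* [Phi] is chosen pointwise, yet it is measurable: Borel sets are preimages under [ev], and [ev]
     composed with [Phi] is [Psi]. *)
  move=> _ B mB; have [B' [mB' ->]] := M1B_preimage mB.
  rewrite (_ : Phi @^-1` _ = (Psi : Omega -> tree_space R) @^-1` B').
    by apply: measurable_tree_space.
  by apply/seteqP; split => w /=; rewrite PhiE.
have [Q QE] := probability_pushforward Pr mPhi.
exists Q => m B mB; rewrite QE.
(* On this almost sure event [Psi w] consists of the unclipped masses. *)
apply: (@probability_eq_on _ _ _ Pr _ _ (good_event `&` V_open)).
- rewrite (_ : Phi @^-1` _ = \bigcap_(e in [set e | size e = m]) ((fun w => Psi w e) @^-1` B e)).
    apply: measurable_bigcap_count => e _; rewrite -[X in measurable X]setTI.
    exact: mPsi.
  apply/seteqP; split => w /= h e em.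
    by have := h e em; rewrite -[fine _]/(ev (Phi w) e) PhiE.
  by rewrite -[fine _]/(ev (Phi w) e) PhiE; exact: h.
- exact: measurable_mass_level.
- exact: measurableI.
- apply: (@etrans _ _ (Pr good_event)); last exact: Pr_good_event.
  apply: (@probability_eq_on _ _ _ Pr _ _ V_open) => //.
  + exact: measurableI.
  + by rewrite -setIA setIid.
- apply/seteqP; split => w /= [h [gw Vw]]; split => // e em.
    have := h e em; rewrite -[fine _]/(ev (Phi w) e) PhiE Psi_mass//.
    by rewrite mass_clip.
  rewrite -[fine _]/(ev (Phi w) e) PhiE Psi_mass// mass_clip//.
  exact: h.
Qed.

End Construction.

Lemma projects_unique (Q Q' : probability (M1B R) R) :
  (forall m, projects_to Pr V Q m) -> (forall m, projects_to Pr V Q' m) ->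
  forall A : set (M1B R), measurable A -> Q A = Q' A.
Proof.
move=> pQ pQ'; apply: M1B_measure_unique => m _ [B [mB ->]].
by have := pQ m B mB; rewrite -(pQ' m B mB).
Qed.

End PolyaTree.

Theorem mainTheorem15 (R : realType) (beta : seq bool -> R)
  (d : measure_display) (Omega : measurableType d) (Pr : probability Omega R)
  (V : seq bool -> Omega -> R) :
  (forall e : seq bool, e != [::] -> 0 < beta e) ->
  (forall e, measurable_fun setT (V e)) ->
  mutually_independent Pr V ->
  (forall e B, measurable B ->
     Pr (V e @^-1` B) = beta_law (beta (rcons e false)) (beta (rcons e true)) B) ->
  ((exists Q : probability (M1B R) R,
      (radon Q /\ forall m, projects_to Pr V Q m) /\
      forall Q' : probability (M1B R) R,
        radon Q' -> (forall m, projects_to Pr V Q' m) ->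
        forall A : set (M1B R), measurable A -> Q' A = Q A)
   <->
   (forall e : seq bool,
      (fun n : nat => \prod_(m < n)
         (beta (e ++ nseq m.+1 false) /
          (beta (e ++ nseq m.+1 false) + beta (e ++ rcons (nseq m false) true))))
      @ \oo --> (0 : R))).
Proof.
move=> beta_gt0 mV indepV lawV.
(* The string [e 0^(m+1)] is the left child of [e 0^m], so the factor of index [m] is the branching
   mean at [e 0^m]. *)
have branchE e : (fun n : nat => \prod_(m < n)
    (beta (e ++ nseq m.+1 false) /
      (beta (e ++ nseq m.+1 false) + beta (e ++ rcons (nseq m false) true)))) =
    (fun n : nat => \prod_(m < n) branch beta (e ++ nseq m false)).
  by apply/funext => n; apply: eq_bigr => m _; rewrite branch_nseq.
split=> [[Q [[_ pQ] _]] e|h].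
  rewrite branchE; exact: (projects_branch_cvg0 beta_gt0 mV indepV lawV pQ).
have branch0 e : \prod_(m < n) branch beta (e ++ nseq m false) @[n --> \oo] --> (0 : R).
  by rewrite -branchE; exact: h.
have [Q pQ] := polya_tree_exists beta_gt0 mV indepV lawV branch0.
exists Q; split=> [|Q' _ pQ' A mA]; first by split=> //; exact: radon_M1.
exact: (projects_unique pQ' pQ).
Qed.
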